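(* Let $K/k$ be a finite Galois extension of fields with group $G=\mathrm{Gal}(K/k)$. Let $N\le \operatorname{Perm}(G)$ be a regular subgroup normalized by $\lambda(G)$, and let $P\triangleleft N$ be a normal subgroup of $N$ that is also normalized by $\lambda(G)$. Let $H_P=(K[P])^{\lambda(G)}$, $F=K^{H_P}$ and $J=\mathrm{Gal}(K/F)\le G$, and assume $J\triangleleft G$. Then the sequence of $k$-Hopf algebras $$1\rightarrow (K[P])^{\lambda(G)}\rightarrow (K[N])^{\lambda(G)}\rightarrow (F[N/P])^{\lambda(G)/\lambda(J)}\rightarrow 1,$$ whose maps are induced by the inclusion $P\hookrightarrow N$ and the quotient map $N\to N/P$, is exact.
   Context: $\operatorname{Perm}(X)$ is the group of permutations of a set $X$; a subgroup of $\operatorname{Perm}(X)$ is regular if it acts transitively on $X$ with trivial point stabilizers. $\lambda:G\to\operatorname{Perm}(G)$ is the left regular representation, $\lambda(a)(b)=ab$; $i_G$ is the identity of $G$. For a subgroup $M\le \operatorname{Perm}(G)$ normalized by $\lambda(G)$, $\lambda(G)$ acts on the group ring $K[M]$ by $\gamma\cdot\sum_{n} c_n n=\sum_n \gamma(c_n)\,\lambda(\gamma)n\lambda(\gamma)^{-1}$ ($\gamma\in G$), and $(K[M])^{\lambda(G)}$ denotes the fixed ring, a $k$-Hopf algebra. For $N$ regular, $H_N=(K[N])^{\lambda(G)}$ acts on $K$ by $h(x)=\sum_{n\in N}c_n\,\bigl(n^{-1}(i_G)\bigr)(x)$ for $h=\sum_{n\in N} c_n n\in H_N$, $x\in K$ (here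 $n^{-1}(i_G)\in G$ is applied to $x$ as an automorphism of $K$). $H_P\subseteq H_N$ is a Hopf subalgebra, and $K^{H_P}=\{x\in K: h(x)=\varepsilon(h)x\ \forall h\in H_P\}$, where $\varepsilon(\sum c_n n)=\sum c_n$; this is an intermediate field of $K/k$. $N$ and $\lambda(G)$ act on the set $G/J$ of left cosets by $n\cdot gJ=n(gJ)=n(g)J$ and $\lambda(\gamma)\cdot gJ=\gamma gJ$, inducing embeddings of $N/P$ and $\lambda(G)/\lambda(J)$ in $\operatorname{Perm}(G/J)$, with $\lambda(G)/\lambda(J)$ normalizing $N/P$. The class of $\lambda(\gamma)$ in $\lambda(G)/\lambda(J)$ acts on $F[N/P]$ by $\sum_{\eta}c_\eta\,\eta P\mapsto\sum_\eta \gamma(c_\eta)\,\lambda(\gamma)\eta\lambda(\gamma)^{-1}P$, and likewise $\lambda(\gamma)$ acts on $K[N/P]$ by the same formula. The second map of the sequence is the restriction to $\lambda(G)$-fixed rings of the $K$-linear extension $K[N]\to K[N/P]$ of $N\to N/P$, where $(K[N/P])^{\lambda(G)}$ and $(F[N/P])^{\lambda(G)/\lambda(J)}$ are equal as subsets of $K[N/P]$. A sequence $1\to A\xrightarrow{i} B\xrightarrow{\pi} C\to 1$ of finite-dimensional $k$-Hopf algebras (the end terms standing for the trivial Hopf algebra $k$) is (short) exact if $i$ is injective, $\pi$ is surjective, $i(A)$ is a normal Hopf subalgebra of $B$, $\ker\pi=B\cdot i(A)^+$ with $i(A)^+=i(A)\cap\ker\varepsilon_B$, and $i(A)=\{b\in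 B:(\mathrm{id}\otimes\pi)\Delta(b)=b\otimes 1\}$. *)

(* Defs.v *)
From HB Require Import structures.
From mathcomp Require Import all_boot all_order all_algebra.
From mathcomp Require Import all_fingroup all_solvable all_field.
Import GRing.Theory.

Set Implicit Arguments.
Unset Strict Implicit.
Unset Printing Implicit Defensive.

Local Open Scope ring_scope.

(* MathComp composes automorphisms and permutations from left to right:       *)
(* (s * t) x = t (s x).  The composite s o t of the usual convention is thus  *)
(* (t * s)%g; this explains every reversed product in this file.              *)

Import VectorInternalTheory.

Section Tensor.
Variable k : fieldType.

(* The entry (i, j) of a tensor is its coordinate on e_i (x) e_j, where the   *)
(* e_i are the vectors mapped to the canonical basis by v2r.                  *)
Definition tensor (U V : vectType k) := 'M[k]_(dim U, dim V).

HB.instance Definition _ (U V : vectType k) := Vector.on (tensor U V).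

Definition vbase (U : vectType k) (i : 'I_(dim U)) : U :=
  r2v (delta_mx 0 i).

Definition tens (U V : vectType k) (u : U) (v : V) : tensor U V :=
  (v2r u)^T *m v2r v.

(* The linear map induced by a bilinear map b : U -> V -> W.                  *)
Definition tlift (U V W : vectType k) (b : U -> V -> W) (t : tensor U V) : W :=
  \sum_i \sum_j t i j *: b (vbase i) (vbase j).

Lemma v2r_vbase (U : vectType k) (u : U) :
  u = \sum_i v2r u 0 i *: vbase i.
Proof.
apply: v2r_inj; rewrite [LHS]row_sum_delta linear_sum.
by apply: eq_bigr => i _; rewrite linearZ /= r2vK.
Qed.

Lemma tlift_tens (U V W : vectType k) (b : U -> V -> W) u v :
  (forall u, linear (b u)) -> (forall v, linear (b^~ v)) ->
  tlift b (tens u v) = b u v.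
Proof.
move=> bR bL; rewrite {2}(v2r_vbase u) {2}(v2r_vbase v) /tlift.
pose f v := GRing.isSemilinear.Build k U W _ (b^~ v)
  (GRing.semilinear_linear (bL v)).
pose lf v : {linear U -> W} := HB.pack (b^~ v) (f v).
pose g u := GRing.isSemilinear.Build k V W _ (b u)
  (GRing.semilinear_linear (bR u)).
pose lg u : {linear V -> W} := HB.pack (b u) (g u).
rewrite -[RHS]/(lf _ _) linear_sum; apply: eq_bigr => i _.
rewrite linearZ /= -[b _ _]/(lg _ _) linear_sum scaler_sumr.
by apply: eq_bigr => j _; rewrite linearZ /= scalerA mxE big_ord1 !mxE.
Qed.

Definition tmap (U V U' V' : vectType k) (f : U -> U') (g : V -> V') :
    tensor U V -> tensor U' V' :=
  tlift (fun u v => tens (f u) (g v)).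

Definition tassoc (U V W : vectType k) :
    tensor (tensor U V) W -> tensor U (tensor V W) :=
  tlift (fun t w => tlift (fun u v => tens u (tens v w)) t).

(* The product (a (x) c) (b (x) d) = ab (x) cd.                               *)
Definition tmul (A B : falgType k) (s t : tensor A B) : tensor A B :=
  tlift (fun a c => tlift (fun b d => tens (a * b) (c * d)) t) s.

End Tensor.

Record hopfAlg (k : fieldType) (H : falgType k) := HopfAlg {
  comul : 'Hom(H, tensor H H);
  counit : 'Hom(H, k^o);
  antipode : 'End(H);
  comulA : forall h, tassoc (tmap comul id (comul h)) = tmap id comul (comul h);
  counitl : forall h, tlift (fun a b => counit a *: b) (comul h) = h;
  counitr : forall h, tlift (fun a b => counit b *: a) (comul h) = h;
  comul1 : comul 1 = tens 1 1;
  comulM : forall g h, comul (g * h) = tmul (comul g) (comul h);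
  counit1 : counit 1 = 1;
  counitM : forall g h, counit (g * h) = counit g * counit h;
  antipodel : forall h, tlift (fun a b => antipode a * b) (comul h) = (counit h)%:A;
  antipoder : forall h, tlift (fun a b => a * antipode b) (comul h) = (counit h)%:A
}.

Section HopfTheory.
Variable k : fieldType.

Record hopf_morphism (A B : falgType k) (hA : hopfAlg A) (hB : hopfAlg B)
    (f : 'Hom(A, B)) : Prop := HopfMorphism {
  hopf_morph1 : f 1 = 1;
  hopf_morphM : forall a b, f (a * b) = f a * f b;
  hopf_morph_comul : forall a, comul hB (f a) = tmap f f (comul hA a);
  hopf_morph_counit : forall a, counit hB (f a) = counit hA a;
  hopf_morph_antipode : forall a, antipode hB (f a) = f (antipode hA a)
}.

Record hopf_subalgebra (B : falgType k) (hB : hopfAlg B) (U : {vspace B}) :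
    Prop := HopfSubalgebra {
  hopf_sub1 : 1 \in U;
  hopf_subM : forall a b, a \in U -> b \in U -> a * b \in U;
  hopf_sub_comul : forall a, a \in U -> exists t : tensor (subvs_of U) (subvs_of U),
    comul hB a = tmap vsval vsval t;
  hopf_sub_antipode : forall a, a \in U -> antipode hB a \in U
}.

(* Stability under the left and right adjoint actions, a |-> b_1 a S(b_2) and *)
(* a |-> S(b_1) a b_2 in Sweedler notation.                                   *)
Record normal_hopf_subalgebra (B : falgType k) (hB : hopfAlg B)
    (U : {vspace B}) : Prop := NormalHopfSubalgebra {
  normal_hopf_sub : hopf_subalgebra hB U;
  normal_adl : forall a b, a \in U ->
    tlift (fun b1 b2 => b1 * a * antipode hB b2) (comul hB b) \in U;
  normal_adr : forall a b, a \in U ->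
    tlift (fun b1 b2 => antipode hB b1 * a * b2) (comul hB b) \in U
}.

Record hopf_short_exact (A B C : falgType k)
    (hA : hopfAlg A) (hB : hopfAlg B) (hC : hopfAlg C)
    (i : 'Hom(A, B)) (p : 'Hom(B, C)) : Prop := HopfShortExact {
  exact_morphl : hopf_morphism hA hB i;
  exact_morphr : hopf_morphism hB hC p;
  exact_inj : injective i;
  exact_surj : forall c, exists b, p b = c;
  exact_normal : normal_hopf_subalgebra hB (limg i);
  exact_ker : lker p = ({:B} * (limg i :&: lker (counit hB)))%VS;
  exact_coker : forall b,
    (b \in limg i) <-> tmap id p (comul hB b) = tens b 1
}.

End HopfTheory.

(* K[T], the group law of T being read from right to left.                    *)
Definition group_ring (k : fieldType) (K : fieldExtType k) (T : finGroupType) :=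
  {ffun T -> K}.

Section GroupRing.
Variables (k : fieldType) (K : fieldExtType k) (T : finGroupType).
Local Notation KT := (group_ring K T).
Implicit Types x y z : KT.

HB.instance Definition _ := Vector.copy KT {ffun T -> K}.

Definition gr_one : KT := [ffun t => (t == 1%g)%:R].
(* The coefficient at s collects the u o t = (t * u)%g equal to s.            *)
Definition gr_mul x y : KT := [ffun s => \sum_u x u * y (s * u^-1)%g].

Fact gr_mulA : associative gr_mul.
Proof.
move=> x y z; apply/ffunP=> s; rewrite !ffunE.
transitivity (\sum_u \sum_t x u * (y t * z (s * u^-1 * t^-1)%g)).
  by apply: eq_bigr => u _; rewrite ffunE mulr_sumr.
transitivity (\sum_u \sum_w x u * y (w * u^-1)%g * z (s * w^-1)%g).
  apply: eq_bigr => u _; rewrite (reindex_inj (mulIg (u^-1)%g)) /=.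
  by apply: eq_bigr => w _; rewrite mulrA invMg invgK !mulgA mulgKV.
by rewrite exchange_big; apply: eq_bigr => w _; rewrite ffunE mulr_suml.
Qed.

Fact gr_mul1l : left_id gr_one gr_mul.
Proof.
move=> x; apply/ffunP=> s; rewrite ffunE (bigD1 1%g) //= big1 => [|u /negPf u1].
  by rewrite ffunE eqxx mul1r invg1 mulg1 addr0.
by rewrite ffunE u1 mul0r.
Qed.

Fact gr_mul1r : right_id gr_one gr_mul.
Proof.
move=> x; apply/ffunP=> s; rewrite ffunE (bigD1 s) //= big1 => [|u /negPf us].
  by rewrite ffunE mulgV eqxx mulr1 addr0.
by rewrite ffunE -eq_mulgV1 eq_sym us mulr0.
Qed.

Fact gr_mulDl : left_distributive gr_mul +%R.
Proof.
move=> x y z; apply/ffunP=> s; rewrite !ffunE -big_split.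
by apply: eq_bigr => u _; rewrite ffunE mulrDl.
Qed.

Fact gr_mulDr : right_distributive gr_mul +%R.
Proof.
move=> x y z; apply/ffunP=> s; rewrite !ffunE -big_split.
by apply: eq_bigr => u _; rewrite ffunE mulrDr.
Qed.

Fact gr_oner_neq0 : gr_one != 0.
Proof.
apply/eqP=> /ffunP/(_ 1%g); rewrite !ffunE eqxx => /eqP.
by rewrite oner_eq0.
Qed.

HB.instance Definition _ := GRing.Zmodule_isNzRing.Build KT
  gr_mulA gr_mul1l gr_mul1r gr_mulDl gr_mulDr gr_oner_neq0.

Fact gr_scaleAl (a : k) x y : a *: (x * y) = (a *: x) * y.
Proof.
apply/ffunP=> s; rewrite !ffunE scaler_sumr.
by apply: eq_bigr => u _; rewrite ffunE scalerAl.
Qed.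
HB.instance Definition _ := GRing.Lmodule_isLalgebra.Build k KT gr_scaleAl.

Fact gr_scaleAr (a : k) x y : a *: (x * y) = x * (a *: y).
Proof.
apply/ffunP=> s; rewrite !ffunE scaler_sumr.
by apply: eq_bigr => u _; rewrite ffunE scalerAr.
Qed.
HB.instance Definition _ := GRing.Lalgebra_isAlgebra.Build k KT gr_scaleAr.
HB.instance Definition _ := Algebra_isFalgebra.Build k KT.

Lemma gr_oneE t : (1 : KT) t = (t == 1%g)%:R.
Proof. by rewrite ffunE. Qed.

Lemma gr_mulE x y s : (x * y) s = \sum_u x u * y (s * u^-1)%g.
Proof. by rewrite ffunE. Qed.

Definition gr_eps x : K := \sum_t x t.

Definition gr_eval (t : T) x : K := x t.

Fact gr_eval_linear t : linear (gr_eval t).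
Proof. by move=> a x y; rewrite /gr_eval !ffunE. Qed.
HB.instance Definition _ t :=
  GRing.isSemilinear.Build k KT K _ (gr_eval t)
    (GRing.semilinear_linear (gr_eval_linear t)).

End GroupRing.

(* The K-linear extension K[T] -> K[T'] of a map phi : T -> T'.               *)
Definition gr_map (k : fieldType) (K : fieldExtType k) (T T' : finGroupType)
    (phi : T -> T') (x : group_ring K T) : group_ring K T' :=
  [ffun t' => \sum_(t | phi t == t') x t].

Section FixedRing.
Variables (k : fieldType) (K : splittingFieldType k) (T : finGroupType).
Variable rho : gal_of {:K} -> T.
Local Notation KT := (group_ring K T).

(* The semilinear action of g on K[T], where g acts on T through conjugation  *)
(* by rho g: it maps \sum_t c_t t to                                          *)
(* \sum_t g(c_t) (rho g o t o (rho g)^-1), and the latter is t ^ rho g.       *)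
Definition gr_act (g : gal_of {:K}) (x : KT) : KT :=
  [ffun t => g (x (t ^ (rho g)^-1)%g)].

Fact gr_act_linear g : linear (gr_act g).
Proof. by move=> a x y; apply/ffunP=> t; rewrite !ffunE linearP. Qed.
HB.instance Definition _ g :=
  GRing.isSemilinear.Build k KT KT _ (gr_act g)
    (GRing.semilinear_linear (gr_act_linear g)).

(* The elements of E[M] fixed by the action, for M a subgroup of T and E an   *)
(* intermediate field; E[M] is the set of the elements of K[T] supported on M *)
(* with coefficients in E.  Being fixed by a quotient of the group through    *)
(* which the action on E[M] factors is the same condition.                    *)
Definition fixed_ring (E : {subfield K}) (M : {group T}) : {vspace KT} :=
  ((\bigcap_(t in M) linfun (@gr_eval k K T t) @^-1: E)
   :&: (\bigcap_(t | t \notin M) lker (linfun (@gr_eval k K T t)))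
   :&: (\bigcap_(g : gal_of {:K}) fixedSpace (linfun (gr_act g))))%VS.

Lemma fixed_ringP (E : {subfield K}) (M : {group T}) (x : KT) :
  reflect [/\ forall t, t \in M -> x t \in E, forall t, t \notin M -> x t = 0
            & forall g, gr_act g x = x]
          (x \in fixed_ring E M).
Proof.
have capP (I : finType) (Q : pred I) (V : I -> {vspace KT}) :
    reflect (forall i, Q i -> x \in V i) (x \in \bigcap_(i | Q i) V i)%VS.
  apply: (iffP idP) => [xV i Qi | xV].
    by move: xV; rewrite (bigD1 i) //= memv_cap => /andP[].
  by elim/big_rec: _ => [|i W Qi xW]; rewrite ?memvf // memv_cap xV.
have evE t : linfun (gr_eval (K := K) t) x = x t by rewrite lfunE.
rewrite /fixed_ring !memv_cap -andbA.
apply: (iffP and3P) => [[/capP xE /capP xM /capP xG]|[xE xM xG]]; split.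
- by move=> t /xE; rewrite -memv_preim evE.
- by move=> t /xM; rewrite memv_ker evE => /eqP.
- by move=> g; have /fixedSpaceP := xG g isT; rewrite lfunE.
- by apply/capP=> t /xE; rewrite -memv_preim evE.
- by apply/capP=> t /xM; rewrite memv_ker evE => ->.
by apply/capP=> g _; apply/fixedSpaceP; rewrite lfunE /= xG.
Qed.

Fact gr_act1 g : gr_act g 1 = 1.
Proof.
apply/ffunP=> t; rewrite ffunE !gr_oneE conjg_eq1.
by case: eqP; rewrite ?rmorph1 ?rmorph0.
Qed.

Fact gr_actM g x y : gr_act g (x * y) = gr_act g x * gr_act g y.
Proof.
apply/ffunP=> s; rewrite ffunE !gr_mulE rmorph_sum.
rewrite (reindex_inj (conjg_inj ((rho g)^-1)%g)) /=; apply: eq_bigr => u _.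
by rewrite !ffunE rmorphM conjMg conjVg.
Qed.

Fact fixed_ring_is_aspace E M : is_aspace (fixed_ring E M).
Proof.
apply/andP; split.
  apply/has_algid1/fixed_ringP; split=> [t _|t tM|g]; last exact: gr_act1.
    by rewrite gr_oneE; case: eqP; rewrite ?mem1v ?mem0v.
  by rewrite gr_oneE; case: eqP tM => // ->; rewrite group1.
apply/prodvP=> x y /fixed_ringP[xE xM xG] /fixed_ringP[yE yM yG].
have supp z (zE : forall t, t \in M -> z t \in E)
    (zM : forall t, t \notin M -> z t = 0) t : z t \in E.
  by case: (boolP (t \in M)) => [/zE|/zM ->] //; rewrite mem0v.
apply/fixed_ringP; split=> [t _|t tM|g]; last by rewrite gr_actM xG yG.
  by rewrite gr_mulE; apply: memv_suml => u _; rewrite memvM ?supp.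
rewrite gr_mulE big1 // => u _; case: (boolP (u \in M)) => [uM|/xM->].
  by rewrite yM ?mulr0 // groupMr ?groupV.
by rewrite mul0r.
Qed.
Canonical fixed_ring_aspace E M := ASpace (fixed_ring_is_aspace E M).

(* The Hopf algebra structure that a fixed ring H inherits from K[T], in      *)
(* which t |-> t (x) t, t |-> 1 and t |-> t^-1 are the comultiplication,      *)
(* counit and antipode.  The first equation reads off the coefficient at      *)
(* (s, t) of the image of comul x in K[T] (x)_K K[T] = K[T x T].  As linearly *)
(* independent elements of H over k are linearly independent over K when K/k  *)
(* is Galois, there is at most one such structure: inherited_hopf_unique.     *)
Record inherited_hopf (H : {aspace KT}) (h : hopfAlg (subvs_of H)) : Prop :=
  InheritedHopf {
  inherited_comul : forall (x : subvs_of H) (s t : T),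
    tlift (fun a b : subvs_of H => vsval a s * vsval b t) (comul h x)
      = if s == t then vsval x s else 0;
  inherited_counit : forall x : subvs_of H, (counit h x)%:A = gr_eps (vsval x);
  inherited_antipode : forall (x : subvs_of H) (t : T),
    vsval (antipode h x) t = vsval x t^-1%g
}.

Hypothesis K_galois : galois 1%AS {:K}.

Lemma fixed_ring_indep E M (I : finType) (v : I -> KT) (c : I -> K) :
    (forall i, v i \in fixed_ring E M) ->
    (forall a : I -> k, \sum_i a i *: v i = 0 -> forall i, a i = 0) ->
    (forall t, \sum_i c i * v i t = 0) -> forall i, c i = 0.
Proof.
move=> vM v_free; have [n] := ubnP #|[pred i | c i != 0]|.
elim: n c => // n IHn c lt_c_n c0 i0; apply/eqP/contraT=> ci0.
pose d i := c i / c i0.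
have d0 t : \sum_i d i * v i t = 0.
  rewrite -[RHS](mul0r (c i0)^-1) -[in RHS](c0 t) mulr_suml.
  by apply: eq_bigr => i _; rewrite /d mulrAC.
have d_fix g i : (g : gal_of {:K}) (d i) = d i.
  apply/eqP; rewrite -subr_eq0; apply/eqP.
  apply: (IHn (fun i => g (d i) - d i)) => [|t]; last first.
    under eq_bigr do rewrite mulrBl; rewrite sumrB d0 subr0.
    rewrite -[RHS](rmorph0 g) -[in RHS](d0 (t ^ (rho g)^-1)%g) rmorph_sum.
    apply: eq_bigr => j _; rewrite [RHS]rmorphM; congr (_ * _).
    by have /fixed_ringP[_ _ /(_ g)/ffunP/(_ t)] := vM j; rewrite ffunE.
  apply: leq_trans (_ : #|[pred i | c i != 0%R]| <= n)%N => //.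
  apply: proper_card.
  apply/properP; split.
    apply/subsetP=> j; rewrite !inE; apply: contraNneq => cj0.
    by rewrite /d cj0 mul0r rmorph0 subrr.
  by exists i0; rewrite !inE // /d divff // rmorph1 subrr eqxx.
have d_k i : {a : k | d i = a%:A}.
  have : d i \in fixedField ('Gal({:K} / 1))%g.
    by apply/fixedFieldP=> [|g _]; rewrite ?memvf ?d_fix.
  have /galois_fixedField-> := K_galois.
  by move/vlineP/sig_eqW.
have /v_free/(_ i0) a0 : \sum_i sval (d_k i) *: v i = 0.
  apply/ffunP=> t; rewrite sum_ffunE ffunE -[RHS](d0 t); apply: eq_bigr => i _.
  by rewrite ffunE [in RHS](svalP (d_k i)) mulr_algl.
have := svalP (d_k i0); rewrite a0 scale0r /d divff // => /eqP.
by rewrite oner_eq0.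
Qed.

Lemma inherited_hopf_unique E M
    (h h' : hopfAlg (subvs_of (fixed_ring_aspace E M))) :
  inherited_hopf h -> inherited_hopf h' ->
  [/\ comul h = comul h', counit h = counit h' & antipode h = antipode h'].
Proof.
move=> [hD he hS] [hD' he' hS']; split; apply/lfunP=> x; last 1 first.
- by apply/val_inj/ffunP=> t; rewrite /= hS hS'.
- pose H := subvs_of (fixed_ring_aspace E M).
  pose v (i : 'I_(dim H)) : KT := vsval (vbase i).
  have vM i : v i \in fixed_ring E M by apply: subvsP.
  have v_free (a : 'I_(dim H) -> k) :
      \sum_i a i *: v i = 0 -> forall i, a i = 0.
    move=> a0 i; have: \sum_i a i *: vbase i = 0 :> H.
      by apply/val_inj; rewrite /= linear_sum /= -[RHS]a0.
    move/(congr1 v2r)/rowP/(_ i).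
    rewrite linear_sum linear0 mxE summxE (bigD1 i) //= big1 => [|j ji].
      by rewrite linearZ /= r2vK !mxE !eqxx mulr1 addr0.
    by rewrite linearZ /= r2vK !mxE eq_sym (negPf ji) mulr0.
  apply/eqP; rewrite -subr_eq0; apply/eqP.
  set t : tensor H H := _ - _.
  have t0 s : forall j, \sum_i (t i j)%:A * v i s = 0.
    apply: fixed_ring_indep vM v_free _ => s'.
    transitivity (tlift (fun a b : H => vsval a s * vsval b s') t).
      rewrite /tlift exchange_big; apply: eq_bigr => j _.
      by rewrite mulr_suml; apply: eq_bigr => i _; rewrite -mulrA mulr_algl.
    transitivity (tlift (fun a b : H => vsval a s * vsval b s') (comul h x)
                - tlift (fun a b : H => vsval a s * vsval b s') (comul h' x)).
      rewrite /tlift -sumrB; apply: eq_bigr => i _; rewrite -sumrB.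
      by apply: eq_bigr => j _; rewrite !mxE scalerBl.
    by rewrite hD hD' subrr.
  apply/matrixP=> i j; rewrite [RHS]mxE; apply: (fmorph_inj (in_alg K)).
  rewrite rmorph0; apply: (fixed_ring_indep (c := fun i => (t i j)%:A) vM v_free).
  by move=> s; apply: t0.
- apply: (fmorph_inj (in_alg K)); exact: etrans (he x) (esym (he' x)).
Qed.

End FixedRing.

Section GreitherPareigis.
Variables (k : fieldType) (K : splittingFieldType k).

(* gal_of {:K} is the group of all k-automorphisms of K.                      *)
Local Notation G := (gal_of {:K}).

Definition regular_subgroup (N : {group {perm G}}) : bool :=
  [transitive N, on [set: G] | 'P] && [forall a : G, ('C_N[a | 'P] == 1)%g].

(* Left translation b |-> g o b.                                              *)
Definition lambda (g : G) : {perm G} := perm (@mulIg G g).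

Definition lambdaG : {set {perm G}} := lambda @: [set: G].

(* When lambda g normalizes P, conjugation by its coset in N(P) / P maps nP to *)
(* (lambda g o n o (lambda g)^-1)P.                                           *)
Definition lambda_coset (P : {group {perm G}}) (g : G) : coset_of P :=
  coset P (lambda g).

Definition hopf_act (h : group_ring K {perm G}) (x : K) : K :=
  \sum_n h n * ((n^-1)%g 1%g : G) x.

Definition is_fixed_field (H : {vspace group_ring K {perm G}})
    (F : {subfield K}) : Prop :=
  forall x : K,
    x \in F <-> (forall h, h \in H -> hopf_act h x = gr_eps h * x).

End GreitherPareigis.

(* Main.v *)
(* By Dedekind's independence of automorphisms, the G-fixed elements of K[M]   *)
(* span K[M] over K, while elements that are independent over k remain         *)
(* independent over K. Hence H (x) H embeds in K[T x T]: every identity can be *)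
(* checked on coefficients, and a G-invariant element of a K-span of fixed     *)
(* elements already lies in their k-span, as one sees by multiplying by an     *)
(* element of trace 1 and summing conjugates. This yields the Hopf structures, *)
(* and reduces surjectivity and the computation of the kernel to K[P], K[N]    *)
(* and K[N/P].                                                                 *)
(*   The field F is the fixed field of {n(1) | n in P}, which is therefore J,  *)
(* and the P-orbits on G are the cosets of J. As J is normal, lambda(J)        *)
(* centralises N modulo P, so a G-invariant element of K[N/P] automatically    *)
(* has its coefficients in F.                                                  *)

Require Import Defs.
From HB Require Import structures.
From mathcomp Require Import all_boot all_order all_algebra.
From mathcomp Require Import all_fingroup all_solvable all_field.

Set Implicit Arguments.
Unset Strict Implicit.
Unset Printing Implicit Defensive.

Import GRing.Theory VectorInternalTheory.
Local Open Scope ring_scope.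

(** After extending scalars to [K] the sequence becomes K[P] -> K[N] -> K[N/P], where exactness is
    read off coefficients; the work is in returning to [k], and two facts do it. By [hev_K_indep]
    and [K_indep_tensor], an element of a fixed ring, or of a tensor power of it over [k], is
    determined by its coefficients in [K]. So the Hopf axioms, the morphism laws
    ([gr_map_hopf_morphism]) and the coinvariants ([projection_coker]) reduce to identities between
    coefficients. By [fixed_ring_span], K[M] is spanned over [K] by fixed elements, and
    [galois_descent] turns a G-invariant combination of these into one over [k]. This produces the
    comultiplication ([comul_exists]), preimages under the projection ([projection_surj]) and the
    decomposition of kernel elements ([sub_lker_projection]).

    The field [F] matters only for the third term. [gal_fixed_field] identifies J with the P-orbit
    of the identity, and [coset_conj_lambda] shows that J, being normal, acts trivially on N/P.
    Hence invariant elements of K[N/P] have coefficients in [F] ([fixed_quotient_coef]), and the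
    third term is handled like the other two. *)

(** * Tensors over [k] tested by [K]-valued forms *)

Section TensorLift.
Variable k : fieldType.
Implicit Types U V W : vectType k.

Lemma eq_tlift U V W (b b' : U -> V -> W) t :
  (forall u v, b u v = b' u v) -> tlift b t = tlift b' t.
Proof.
by move=> eb; apply: eq_bigr => i _; apply: eq_bigr => j _; rewrite eb.
Qed.

Lemma tlift_linear U V W (b : U -> V -> W) : linear (tlift b).
Proof.
move=> a s t; rewrite /tlift scaler_sumr -big_split; apply: eq_bigr => i _.
rewrite scaler_sumr -big_split; apply: eq_bigr => j _ /=.
by rewrite !mxE scalerDl scalerA.
Qed.

Lemma linear_lift U V (f : U -> V) :
  linear f -> exists l : {linear U -> V}, f = l.
Proof.
move=> f_lin; pose m := GRing.isSemilinear.Build k U V _ f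
  (GRing.semilinear_linear f_lin).
by exists (HB.pack_for {linear U -> V} f m).
Qed.

Lemma linear_tlift U V W W' (L : W -> W') (b : U -> V -> W) t :
  linear L -> L (tlift b t) = tlift (fun u v => L (b u v)) t.
Proof.
move=> /linear_lift[l ->]; rewrite linear_sum; apply: eq_bigr => i _.
by rewrite linear_sum; apply: eq_bigr => j _; rewrite linearZ.
Qed.

Lemma tlift_sum U V W (I : finType) (Q : pred I) (b : I -> U -> V -> W) t :
  tlift (fun u v => \sum_(i | Q i) b i u v) t = \sum_(i | Q i) tlift (b i) t.
Proof.
rewrite /tlift [RHS]exchange_big; apply: eq_bigr => i _ /=.
rewrite [RHS]exchange_big; apply: eq_bigr => j _ /=.
by rewrite scaler_sumr.
Qed.

Lemma tens_linearr U V (u : U) : linear (@tens k U V u).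
Proof. by move=> a v w; rewrite /tens !linearP. Qed.

Lemma tens_linearl U V (v : V) : linear ((@tens k U V)^~ v).
Proof.
move=> a u w; rewrite /tens !linearP /=.
by rewrite mulmxDl scalemxAl.
Qed.

Variable K : fieldExtType k.

(** When [e] and [f] read off coefficients at s and t, this is the coefficient of the tensor at (s,
    t). *)
Definition tev U V (e : U -> K) (f : V -> K) : tensor U V -> K :=
  tlift (fun u v => e u * f v).

Lemma tev_tens U V (e : U -> K) (f : V -> K) u v :
  linear e -> linear f -> tev e f (tens u v) = e u * f v.
Proof.
move=> e_lin f_lin; rewrite /tev tlift_tens // => [{}u a x y|{}v a x y].
  by rewrite f_lin mulrDr scalerAr.
by rewrite e_lin mulrDl scalerAl.
Qed.

Lemma tev_linear U V (e : U -> K) (f : V -> K) : linear (tev e f).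
Proof. exact: tlift_linear. Qed.

Lemma tev_tmap U V U' V' (e : U' -> K) (f : V' -> K) (g : U -> U') (h : V -> V') t :
    linear e -> linear f ->
  tev e f (tmap g h t) = tev (e \o g) (f \o h) t.
Proof.
move=> e_lin f_lin; rewrite (linear_tlift _ _ (tev_linear e f)).
by apply: eq_tlift => u v; rewrite tev_tens.
Qed.

Lemma tev_tassoc U V W (e : U -> K) (f : V -> K) (g : W -> K) t :
    linear e -> linear f -> linear g ->
  tev e (tev f g) (tassoc t) = tev (tev e f) g t.
Proof.
move=> e_lin f_lin g_lin; rewrite (linear_tlift _ _ (tev_linear _ _)).
apply: eq_tlift => s w; rewrite (linear_tlift _ _ (tev_linear _ _)).
rewrite (@linear_tlift _ _ _ _ (fun x => x * g w)) => [|a x y]; last first.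
  by rewrite mulrDl scalerAl.
apply: eq_tlift => u v; rewrite !tev_tens ?mulrA //; exact: tev_linear.
Qed.

(* The k-linear forms e x : U -> K embed K (x) U into the functions X -> K.    *)
Definition K_indep U (X : Type) (e : X -> U -> K) : Prop :=
  forall c : 'I_(dim U) -> K,
  (forall x, \sum_i c i * e x (vbase i) = 0) -> forall i, c i = 0.

(** The coordinates of [u - v] are the coefficients of a relation that [K_indep] forces to be
    trivial. *)
Lemma K_indep_inj U X (e : X -> U -> K) u v :
  (forall x, linear (e x)) -> K_indep e -> (forall x, e x u = e x v) -> u = v.
Proof.
move=> e_lin e_inj euv; apply: v2r_inj; apply/rowP=> i.
apply: (fmorph_inj (in_alg K)); apply/eqP; rewrite -subr_eq0 -rmorphB; apply/eqP.
apply: (e_inj (fun i => in_alg K (v2r u 0 i - v2r v 0 i))) => x.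
have [l el] := linear_lift (e_lin x).
transitivity (l (u - v)); last by rewrite linearB -el euv subrr.
rewrite [u - v]v2r_vbase linear_sum; apply: eq_bigr => j _.
by rewrite linearZ linearB !mxE /= mulr_algl el.
Qed.

(** A relation is peeled one variable at a time: independence of [e] for fixed [y], after
    independence of [f], kills every entry of the combined tensor. *)
Lemma K_indep_tensor U V (X Y : Type) (e : X -> U -> K) (f : Y -> V -> K) :
  K_indep e -> K_indep f ->
  K_indep (fun xy : X * Y => tev (e xy.1) (f xy.2)).
Proof.
move=> e_inj f_inj c c0 l.
pose d i j := \sum_m c m * ((vbase m : tensor U V) i j)%:A.
have d0 i j : d i j = 0.
  move: i; apply: e_inj => x; move: j; apply: f_inj => y.
  rewrite -[RHS](c0 (x, y)).
  transitivity (\sum_m \sum_i \sum_j c m *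
      (((vbase m : tensor U V) i j)%:A * (e x (vbase i) * f y (vbase j)))).
    rewrite [RHS]exchange_big /=.
    under [RHS]eq_bigr do rewrite exchange_big /=.
    rewrite [RHS]exchange_big /=; apply: eq_bigr => j _.
    rewrite mulr_suml; apply: eq_bigr => i _; rewrite /d !mulr_suml.
    by apply: eq_bigr => m _; rewrite -!mulrA.
  apply: eq_bigr => m _; rewrite /tev /tlift mulr_sumr; apply: eq_bigr => i _.
  by rewrite mulr_sumr; apply: eq_bigr => j _; rewrite mulr_algl.
(* The basis [vbase] of the tensor space is indexed by one ordinal; expanding its members in matrix
   units recovers [c l] from the entries [d i j]. *)
transitivity (\sum_i \sum_j d i j * (v2r (delta_mx i j : tensor U V) 0 l)%:A).
  transitivity (\sum_m c m * (v2r (vbase m : tensor U V) 0 l)%:A).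
    rewrite (bigD1 l) //= r2vK mxE !eqxx scale1r mulr1 big1 ?addr0 // => m ml.
    by rewrite r2vK mxE eq_sym (negPf ml) scale0r mulr0.
  transitivity (\sum_m \sum_i \sum_j c m * ((vbase m : tensor U V) i j)%:A *
      (v2r (delta_mx i j : tensor U V) 0 l)%:A).
    apply: eq_bigr => m _.
    rewrite [X in v2r X](matrix_sum_delta (vbase m : 'M_(_, _))).
    rewrite linear_sum summxE scaler_suml mulr_sumr; apply: eq_bigr => i _.
    rewrite linear_sum summxE scaler_suml mulr_sumr; apply: eq_bigr => j _.
    by rewrite linearZ mxE -mulrA mulr_algl scalerA.
  rewrite exchange_big; apply: eq_bigr => i _.
  by rewrite exchange_big; apply: eq_bigr => j _; rewrite /d mulr_suml.
by rewrite big1 // => i _; rewrite big1 // => j _; rewrite d0 mul0r.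
Qed.

(** Turns existence element by element into a [k]-linear map: witnesses are chosen on a basis only
    and extended linearly. *)
Lemma lfun_choice U W (X : Type) (a : X -> U -> K) (b : X -> W -> K) :
    (forall x, linear (a x)) -> (forall x, linear (b x)) ->
    (forall u, exists w, forall x, b x w = a x u) ->
  exists f : 'Hom(U, W), forall u x, b x (f u) = a x u.
Proof.
move=> a_lin b_lin ab.
have /fin_all_exists[w wP] i : exists w, forall x, b x w = a x (vbase i).
  exact: ab.
pose g u := \sum_i v2r u 0 i *: w i.
have /linear_lift[l gl] : linear g.
  move=> c u v; rewrite /g scaler_sumr -big_split; apply: eq_bigr => i _ /=.
  by rewrite linearP !mxE scalerDl scalerA.
exists (linfun l) => u x; rewrite lfunE -gl /g.
have [la la_a] := linear_lift (a_lin x); have [lb lb_b] := linear_lift (b_lin x).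
rewrite [in RHS](v2r_vbase u) la_a lb_b !linear_sum; apply: eq_bigr => i _.
by rewrite !linearZ /= -la_a -lb_b wP.
Qed.
End TensorLift.

(** * Dedekind independence and Galois descent *)

Section Descent.
Variables (k : fieldType) (K : splittingFieldType k).
Local Notation G := (gal_of {:K}).

(** The matrix of values g(e_j) on a [k]-basis has independent rows by Dedekind, hence a right
    inverse; [d] is the column of that inverse at the identity. *)
Lemma gal_dual_basis : exists n (c d : 'I_n -> K),
  forall g : G, \sum_j d j * g (c j) = (g == 1%g)%:R.
Proof.
pose A := \matrix_(i < #|{: G}|, j < dim K) (enum_val i : G) (vbase j).
have /row_freeP[B /matrixP AB1] : row_free A.
  rewrite -kermx_eq0; apply/rowV0P=> v /sub_kermxP/rowP vA0; apply/rowP=> i.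
  rewrite mxE -(enum_valK i); move: {i}(enum_val i) (erefl true).
  apply: (gal_independent (c_ := fun g : G => v 0 (enum_rank g))) => a _.
  have a_sum (g : G) : g a = \sum_j v2r a 0 j *: g (vbase j).
    by rewrite {1}[a]v2r_vbase linear_sum; apply: eq_bigr => j _; rewrite linearZ.
  under eq_bigr do rewrite a_sum mulr_sumr.
  rewrite exchange_big big1 // => j _ /=.
  under eq_bigr do rewrite -scalerAr.
  rewrite -scaler_sumr (reindex _ (onW_bij _ (enum_val_bij G))) /=.
  have vA0j : \sum_i v 0 i * A i j = 0 by have := vA0 j; rewrite !mxE.
  rewrite -[RHS](scaler0 _ (v2r a 0 j)) -[in RHS]vA0j; congr (_ *: _).
  by apply: eq_bigr => i _; rewrite enum_valK mxE.
exists (dim K), (@vbase k K), (fun j => B j (enum_rank 1%g)) => g.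
have := AB1 (enum_rank g) (enum_rank 1%g); rewrite !mxE.
under eq_bigr do rewrite mxE enum_rankK mulrC.
by move=> ->; rewrite (inj_eq enum_rank_inj).
Qed.

Hypothesis K_galois : galois 1%AS {:K}.

Lemma fixed_in_base (a : K) :
  (forall g : G, g a = a) -> exists b : k, a = b%:A.
Proof.
move=> a_fix; apply/vlineP; rewrite -(galois_fixedField K_galois).
by apply/fixedFieldP=> [|g _]; rewrite ?memvf ?a_fix.
Qed.

(** Dedekind provides an element of nonzero trace; dividing by its trace, which is Galois-invariant,
    normalizes it. *)
Lemma trace_one : exists c : K, \sum_(g : G) g c = 1.
Proof.
have [a _ ta0] := gal_independent_contra (E := {:K}%AS) (P := predT)
  (c_ := fun=> 1) (x := 1%g) isT (oner_neq0 K).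
set t := \sum_(y | _) _ in ta0.
exists (a / t); rewrite -(divff ta0) {1}/t mulr_suml; apply: eq_bigr => g _.
rewrite rmorphM fmorphV mul1r; congr (_ / _).
rewrite /t rmorph_sum [RHS](reindex_inj (mulIg g)); apply: eq_bigr => h _.
by rewrite !mul1r galM ?memvf.
Qed.

(* Multiply the expression of Y by an element of trace 1 and sum its          *)
(* conjugates: the coefficients become traces.                                *)
Lemma galois_descent (W : vectType k) (U : {vspace W}) (X : Type)
    (act : G -> X -> X) (e : X -> W -> K) (Y : X -> K)
    (I : finType) (b : I -> K) (w : I -> W) :
    (forall x, linear (e x)) ->
    (forall (g : G) x v, v \in U -> e x v = g (e (act g x) v)) ->
    (forall (g : G) x, Y x = g (Y (act g x))) ->
    (forall i, w i \in U) -> (forall x, Y x = \sum_i b i * e x (w i)) ->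
  exists2 v, v \in U & forall x, e x v = Y x.
Proof.
move=> e_lin e_act Y_act wU Yb; have [c c1] := trace_one.
have /fin_all_exists[a aP] i : exists a, \sum_(g : G) g (c * b i) = a%:A.
  apply: fixed_in_base => g; rewrite rmorph_sum [RHS](reindex_inj (mulIg g)).
  by apply: eq_bigr => h _; rewrite galM ?memvf.
exists (\sum_i a i *: w i) => [|x]; first by apply: memv_suml => i _; rewrite memvZ.
have [l el] := linear_lift (e_lin x); rewrite el linear_sum.
rewrite -[RHS]mul1r -c1 mulr_suml.
transitivity (\sum_i \sum_(g : G) g (c * b i) * e x (w i)).
  by apply: eq_bigr => i _; rewrite linearZ -el -mulr_suml aP mulr_algl.
rewrite exchange_big; apply: eq_bigr => g _ /=.
rewrite (Y_act g) -rmorphM Yb mulr_sumr rmorph_sum; apply: eq_bigr => i _.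
by rewrite (e_act g) // -rmorphM mulrA.
Qed.

End Descent.

(** * Fixed elements span the group ring over [K] *)

Section FixedRingSpan.
Variables (k : fieldType) (K : splittingFieldType k) (T : finGroupType).
Local Notation G := (gal_of {:K}).
Variable rho : G -> T.
Hypothesis rhoM : {morph rho : g h / (g * h)%g}.
Local Notation KT := (group_ring K T).

Definition gr_trace (c : K) (x : KT) : KT :=
  \sum_(g : G) gr_act rho g [ffun t => c * x t].

Lemma gr_traceE c x t :
  gr_trace c x t = \sum_(g : G) g c * g (x (t ^ (rho g)^-1)%g).
Proof.
by rewrite sum_ffunE; apply: eq_bigr => g _; rewrite !ffunE rmorphM.
Qed.

Lemma gr_act_trace g c x : gr_act rho g (gr_trace c x) = gr_trace c x.
Proof.
apply/ffunP=> t; rewrite ffunE !gr_traceE rmorph_sum.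
rewrite [RHS](reindex_inj (mulIg g)); apply: eq_bigr => h _.
by rewrite rmorphM !galM ?memvf // rhoM invMg conjgM.
Qed.

Lemma gr_trace_eps c x :
  gr_eps (gr_trace c x) = \sum_(g : G) g c * g (gr_eps x).
Proof.
transitivity (\sum_t \sum_(g : G) g c * g (x (t ^ (rho g)^-1)%g)).
  by apply: eq_bigr => t _; rewrite gr_traceE.
rewrite exchange_big; apply: eq_bigr => g _; rewrite -mulr_sumr; congr (_ * _).
by rewrite rmorph_sum [RHS](reindex_inj (conjg_inj (rho g)^-1%g)).
Qed.

Definition supported (M : {set T}) (x : KT) := forall t, t \notin M -> x t = 0.

Lemma fixed_ring_supp E M x : x \in fixed_ring rho E M -> supported M x.
Proof. by case/fixed_ringP. Qed.

Lemma fixed_ring_act E M x (g : G) t :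
  x \in fixed_ring rho E M -> x t = g (x (t ^ (rho g)^-1)%g).
Proof.
by case/fixed_ringP=> _ _ /(_ g)/ffunP/(_ t); rewrite ffunE.
Qed.

Variables (E : {subfield K}) (M : {group T}).
Hypothesis rho_norm : forall g, rho g \in 'N(M)%g.
(* The coefficients of a fixed element lie in E automatically when E is K, and *)
(* also for F[N/P], where it is the normality of J that is used.               *)
Hypothesis fixed_coef : forall x : KT,
  supported M x -> (forall g, gr_act rho g x = x) -> forall t, x t \in E.
Local Notation H := (fixed_ring rho E M).

Lemma mem_fixed_ring x :
  supported M x -> (forall (g : G) t, x t = g (x (t ^ (rho g)^-1)%g)) -> x \in H.
Proof.
move=> xM x_act; have x_fix g : gr_act rho g x = x.
  by apply/ffunP=> t; rewrite ffunE -x_act.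
by apply/fixed_ringP; split=> // t _; apply: fixed_coef.
Qed.

Lemma supported_trace c x : supported M x -> supported M (gr_trace c x).
Proof.
move=> xM t tM; rewrite gr_traceE big1 // => g _.
by rewrite xM ?rmorph0 ?mulr0 // memJ_norm // groupV.
Qed.

Lemma gr_trace_fixed c x : supported M x -> gr_trace c x \in H.
Proof.
move=> xM; apply: mem_fixed_ring => [|g t]; first exact: supported_trace.
by rewrite -{1}(gr_act_trace g) ffunE.
Qed.

(** With [c], [d] from [gal_dual_basis], the sum of d_j Tr(c_j x) has coefficient \sum_j d_j g(c_j)
    on the conjugate of [x] by g, so only g = 1 survives. The scalars [b] do not depend on [x]. The
    augmentation clause is what the kernel computation needs to stay inside the augmentation
    ideal. *)
Lemma fixed_ring_span : exists n (b : 'I_n -> K),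
  forall x : KT, supported M x -> exists w : 'I_n -> KT,
    [/\ forall i, w i \in H, gr_eps x = 0 -> forall i, gr_eps (w i) = 0
      & forall t, x t = \sum_i b i * w i t].
Proof.
have [n [c [d cd]]] := gal_dual_basis K.
exists n, d => x xM; exists (fun i => gr_trace (c i) x).
have rho1 : rho 1%g = 1%g.
  by apply: (mulgI (rho 1%g)); rewrite -rhoM !mulg1.
split=> [i|x0 i|t]; first exact: gr_trace_fixed.
  by rewrite gr_trace_eps x0 big1 // => g _; rewrite rmorph0 mulr0.
under eq_bigr do rewrite gr_traceE mulr_sumr.
rewrite exchange_big (bigD1 1%g) //= [X in _ + X]big1 => [|g /negPf g1].
  under eq_bigr do rewrite mulrA.
  by rewrite -mulr_suml cd eqxx mul1r addr0 gal_id rho1 invg1 conjg1.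
under eq_bigr do rewrite mulrA.
by rewrite -mulr_suml cd g1 mul0r.
Qed.

End FixedRingSpan.

(** * Coefficients of elements of a fixed ring *)

Section FixedRingEval.
Variables (k : fieldType) (K : splittingFieldType k) (T : finGroupType).
Local Notation G := (gal_of {:K}).
Variables (rho : G -> T) (E : {subfield K}) (M : {group T}).
Local Notation H := (fixed_ring_aspace rho E M).
Local Notation HA := (subvs_of H).

Definition hev (t : T) (x : HA) : K := vsval x t.

Lemma hev_linear t : linear (hev t).
Proof. by move=> c x y; rewrite /hev linearP !ffunE. Qed.

Lemma hev_inj x y : (forall t, hev t x = hev t y) -> x = y.
Proof. by move=> exy; apply/val_inj/ffunP. Qed.

Lemma hev1 t : hev t 1 = (t == 1%g)%:R.
Proof.
(* The unit of [subvs_of H] is [algid H], which is the unit of K[T] once the latter is known to lie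
   in [H]. *)
rewrite /hev [vsval _](_ : _ = 1) ?gr_oneE //; apply/eqP.
rewrite algid_eq1; apply/fixed_ringP; split=> [s _|s sM|g]; last exact: gr_act1.
  by rewrite gr_oneE; case: eqP; rewrite ?mem1v ?mem0v.
by rewrite gr_oneE; case: eqP sM => // ->; rewrite group1.
Qed.

Lemma hevM t x y : hev t (x * y) = \sum_u hev u x * hev (t * u^-1)%g y.
Proof. by rewrite /hev gr_mulE. Qed.

Lemma hev_supp t x : t \notin M -> hev t x = 0.
Proof. by apply: fixed_ring_supp (subvsP x) t. Qed.

Lemma hev_act (g : G) t x : hev t x = g (hev (t ^ (rho g)^-1)%g x).
Proof. exact: fixed_ring_act (subvsP x). Qed.

Lemma hev_vsproj x t : x \in H -> hev t (vsproj H x) = x t.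
Proof. by move=> xH; rewrite /hev vsprojK. Qed.

Hypothesis K_galois : galois 1%AS {:K}.

(** This is the injectivity of K (x)_k H -> K[T]. *)
Lemma hev_K_indep : K_indep hev.
Proof.
move=> c; apply: (fixed_ring_indep K_galois (E := E) (M := M)).
  by move=> i; apply: subvsP.
move=> a a0 i; have: \sum_i a i *: vbase i = 0 :> HA.
  by apply/val_inj; rewrite /= linear_sum /= -[RHS]a0.
move/(congr1 v2r)/rowP/(_ i).
rewrite linear_sum linear0 mxE summxE (bigD1 i) //= big1 => [|j ji].
  by rewrite linearZ /= r2vK !mxE !eqxx mulr1 addr0.
by rewrite linearZ /= r2vK !mxE eq_sym (negPf ji) mulr0.
Qed.

End FixedRingEval.

Section SweedlerSums.
Variables (k : fieldType) (K : fieldExtType k) (U V : vectType k).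

Lemma tlift_sum1 (I : finType) (e : I -> U -> K) (f : I -> V -> K) t :
  tlift (fun u v => \sum_i e i u * f i v) t = \sum_i tev (e i) (f i) t.
Proof. exact: tlift_sum. Qed.

Lemma tlift_sum2 (I J : finType) (phi : I -> J -> K) (e : I -> U -> K)
    (f : J -> V -> K) t :
  tlift (fun u v => \sum_i \sum_j phi i j * (e i u * f j v)) t =
    \sum_i \sum_j phi i j * tev (e i) (f j) t.
Proof.
rewrite tlift_sum; apply: eq_bigr => i _; rewrite tlift_sum.
apply: eq_bigr => j _; rewrite -linear_tlift // => a x y.
by rewrite mulrDr scalerAr.
Qed.

End SweedlerSums.

(** * Construction of the counit, antipode and comultiplication *)

Section FixedHopf.
Variables (k : fieldType) (K : splittingFieldType k) (T : finGroupType).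
Hypothesis K_galois : galois 1%AS {:K}.
Local Notation G := (gal_of {:K}).
Local Notation KT := (group_ring K T).
Variables (rho : G -> T) (E : {subfield K}) (M : {group T}).
Hypothesis rhoM : {morph rho : g h / (g * h)%g}.
Hypothesis rho_norm : forall g, rho g \in 'N(M)%g.
Hypothesis fixed_coef : forall x : KT,
  supported M x -> (forall g, gr_act rho g x = x) -> forall t, x t \in E.
Local Notation H := (fixed_ring_aspace rho E M).
Local Notation HA := (subvs_of H).
Local Notation hev := (@hev k K T rho E M).

Lemma gr_eps_linear : linear (fun x : HA => gr_eps (vsval x)).
Proof.
move=> c x y; rewrite /gr_eps scaler_sumr -big_split; apply: eq_bigr => t _ /=.
exact: hev_linear.
Qed.

Lemma counit_exists : exists eps : 'Hom(HA, k^o),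
  forall x, (eps x)%:A = gr_eps (vsval x).
Proof.
have [||x|eps epsP] := @lfun_choice k K HA k^o unit
    (fun _ x => gr_eps (vsval x)) (fun _ => in_alg K).
- by move=> _; apply: gr_eps_linear.
- by move=> _ c x y; rewrite /= scalerDl scalerA.
- have [g|b bP] := @fixed_in_base _ _ K_galois (gr_eps (vsval x)).
    rewrite rmorph_sum (reindex_inj (conjg_inj (rho g)^-1%g)).
    by apply: eq_bigr => t _; rewrite [RHS](hev_act g).
  by exists b => _.
by exists eps => x; rewrite -(epsP x tt).
Qed.

Lemma antipode_exists : exists S : 'End(HA),
  forall x t, hev t (S x) = hev t^-1%g x.
Proof.
apply: lfun_choice => [t|t|x]; [exact: hev_linear | exact: hev_linear |].
pose y : KT := [ffun t => hev t^-1%g x].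
exists (vsproj H y) => t; rewrite hev_vsproj ?ffunE //.
apply: mem_fixed_ring => // [s sM|g s]; first by rewrite ffunE hev_supp ?groupV.
by rewrite !ffunE (hev_act g) conjVg.
Qed.

(** The group element u of K[M], replaced by 0 when u is outside [M] so that the support condition
    always holds. *)
Definition gr_point (u : T) : KT := [ffun t => ((t == u) && (t \in M))%:R].

Lemma supported_point u : supported M (gr_point u).
Proof. by move=> t /negPf tM; rewrite ffunE tM andbF. Qed.

(** The target is \sum_u x_u u (x) u. Expanding both copies of u on fixed elements writes it as a
    [K]-combination of tensors over [k]; its coefficients are invariant under the diagonal action on
    T x T, so it descends. *)
Lemma comul_exists : exists D : 'Hom(HA, tensor HA HA),
  forall x s t, tev (hev s) (hev t) (D x) = if s == t then hev s x else 0.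
Proof.
have [||x|D DP] := @lfun_choice k K HA (tensor HA HA) (T * T)
  (fun p x => if p.1 == p.2 then hev p.1 x else 0)
  (fun p => tev (hev p.1) (hev p.2)); last by exists D => x s t; rewrite (DP x (s, t)).
- move=> [s t] c x y /=; case: eqP => _; first exact: hev_linear.
  by rewrite scaler0 addr0.
- by move=> p; apply: tev_linear.
have [n [b bP]] := fixed_ring_span rhoM rho_norm fixed_coef.
have /fin_all_exists[w wP] u := bP _ (supported_point u).
pose act (g : G) (p : T * T) := (p.1 ^ (rho g)^-1, p.2 ^ (rho g)^-1)%g.
pose c (i : T * ('I_n * 'I_n)) := hev i.1 x * (b i.2.1 * b i.2.2).
pose v (i : T * ('I_n * 'I_n)) : tensor HA HA :=
  tens (vsproj H (w i.1 i.2.1)) (vsproj H (w i.1 i.2.2)).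
have [||||p|D _ DP] := @galois_descent k K K_galois (tensor HA HA) fullv
  (T * T) act (fun p => tev (hev p.1) (hev p.2))
  (fun p => if p.1 == p.2 then hev p.1 x else 0) _ c v; last by exists D.
- by move=> p; apply: tev_linear.
- move=> g p D _; rewrite [RHS]linear_tlift; last exact: linearP.
  by apply: eq_tlift => y z; rewrite rmorphM /= -!hev_act.
- move=> g [s t] /=; rewrite (inj_eq (conjg_inj _)) [RHS]fun_if rmorph0.
  by rewrite -hev_act.
- by move=> i; apply: memvf.
case: p => s t /=; transitivity
    (\sum_u \sum_i \sum_j c (u, (i, j)) * (w u i s * w u j t)); last first.
  transitivity (\sum_u \sum_(q : 'I_n * 'I_n) c (u, q) * (w u q.1 s * w u q.2 t)).
    by apply: eq_bigr => u _; rewrite pair_bigA; apply: eq_bigr => -[].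
  rewrite pair_bigA.
  apply: eq_bigr => -[u [i j]] _ /=.
  have [wH _ _] := wP u; rewrite tev_tens; try exact: hev_linear.
  by rewrite !hev_vsproj.
transitivity (\sum_u hev u x * (gr_point u s * gr_point u t)).
  rewrite (bigD1 s) //= big1 => [|u /negPf us]; last first.
    by rewrite ffunE eq_sym us mul0r mulr0.
  rewrite !ffunE eqxx eq_sym addr0; case: eqP => [->|_]; last by rewrite !mulr0.
  by case: (boolP (s \in M)) => [_|/hev_supp->]; rewrite ?mul0r ?mulr1.
apply: eq_bigr => u _; have [_ _ wu] := wP u.
rewrite (wu s) (wu t) mulr_suml mulr_sumr; apply: eq_bigr => i _.
rewrite !mulr_sumr; apply: eq_bigr => j _.
by rewrite /c /= -!mulrA; congr (_ * (_ * _)); rewrite mulrCA.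
Qed.

End FixedHopf.

(** * The Hopf axioms, checked on coefficients *)

Section GroupLikeComul.
Variables (k : fieldType) (K : splittingFieldType k) (T : finGroupType).
Hypothesis K_galois : galois 1%AS {:K}.
Local Notation G := (gal_of {:K}).
Variables (rho : G -> T) (E : {subfield K}) (M : {group T}).
Local Notation H := (fixed_ring_aspace rho E M).
Local Notation HA := (subvs_of H).
Local Notation hev := (@hev k K T rho E M).
Local Notation hev_lin := (@hev_linear k K T rho E M).

Variable D : 'Hom(HA, tensor HA HA).
Hypothesis D_ev : forall x s t,
  tev (hev s) (hev t) (D x) = if s == t then hev s x else 0.

Lemma tlift_comul_sum (I : finType) (p q : I -> T) x :
  tlift (fun a b => \sum_i hev (p i) a * hev (q i) b) (D x) =
    \sum_(i | p i == q i) hev (p i) x.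
Proof.
by rewrite tlift_sum1 [RHS]big_mkcond; apply: eq_bigr => i _; rewrite D_ev.
Qed.

Lemma tev_hev_inj (s t : tensor HA HA) :
  (forall u v, tev (hev u) (hev v) s = tev (hev u) (hev v) t) -> s = t.
Proof.
move=> est; apply: (K_indep_inj (e := fun p => tev (hev p.1) (hev p.2))).
- by move=> p; apply: tev_linear.
- by apply: K_indep_tensor; apply: hev_K_indep.
by move=> p; apply: est.
Qed.

(** At (s, t, u) both sides have the coefficient of [x] at s if s = t = u, and 0 otherwise. *)
Lemma comulA_of_ev x : tassoc (tmap D id (D x)) = tmap id D (D x).
Proof.
apply: (K_indep_inj (e := fun p => tev (hev p.1) (tev (hev p.2.1) (hev p.2.2)))).
- by move=> p; apply: tev_linear.
- apply: (K_indep_tensor (f := fun p => tev (hev p.1) (hev p.2))).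
    exact: hev_K_indep.
  by apply: K_indep_tensor; apply: hev_K_indep.
move=> [s [t u]] /=; rewrite tev_tassoc; try exact: hev_lin.
rewrite !tev_tmap; try exact: hev_lin; try exact: tev_linear.
transitivity (if s == t then if t == u then hev s x else 0 else 0).
  transitivity (tlift (fun a b => (s == t)%:R * (hev s a * hev u b)) (D x)).
    by apply: eq_tlift => a b /=; rewrite D_ev; case: eqP; rewrite ?mul1r ?mul0r.
  rewrite -linear_tlift => [|c y z]; last by rewrite mulrDr scalerAr.
  rewrite -/(tev _ _ _) D_ev; have [->|_] := eqVneq s t; last by rewrite mul0r.
  by rewrite mul1r.
transitivity (tlift (fun a b => (t == u)%:R * (hev s a * hev t b)) (D x)).
  rewrite -linear_tlift => [|c y z]; last by rewrite mulrDr scalerAr.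
  rewrite -/(tev _ _ _) D_ev; have [_|_] := eqVneq t u; first by rewrite mul1r.
  by rewrite mul0r; case: eqP.
by apply: eq_tlift => a b /=; rewrite D_ev; case: eqP; rewrite ?mul1r ?mul0r ?mulr0.
Qed.

Lemma comul1_of_ev : D 1 = tens 1 1.
Proof.
apply: tev_hev_inj => s t; rewrite D_ev tev_tens; try exact: hev_lin.
rewrite !hev1 -natrM mulnb; have [<-|st] := eqVneq s t; first by rewrite andbb.
by case: eqP => // s1; case: eqP => // t1; rewrite s1 t1 eqxx in st.
Qed.

Lemma comulM_of_ev x y : D (x * y) = tmul (D x) (D y).
Proof.
apply: tev_hev_inj => s t; rewrite D_ev [RHS]linear_tlift; last exact: tev_linear.
(* The contribution of [D y] once [D x] has supplied the pair (u, v); since [D x] lives on the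
   diagonal, only [d u u] remains. *)
pose d u v := if (s * u^-1 == t * v^-1)%g then hev (s * u^-1)%g y else 0.
rewrite (@eq_tlift _ _ _ _ _ (fun a c => \sum_u \sum_v d u v * (hev u a * hev v c))).
  rewrite tlift_sum2 hevM; transitivity (\sum_u d u u * hev u x).
    case: eqP => [st|/eqP/negPf st].
      by apply: eq_bigr => u _; rewrite /d st eqxx mulrC.
    by rewrite big1 // => u _; rewrite /d (inj_eq (mulIg _)) st mul0r.
  apply: eq_bigr => u _; rewrite (bigD1 u) //= D_ev eqxx big1 ?addr0 // => v vu.
  by rewrite D_ev eq_sym (negPf vu) mulr0.
move=> a c; rewrite linear_tlift; last exact: tev_linear.
rewrite (@eq_tlift _ _ _ _ _ (fun b e => \sum_u \sum_v (hev u a * hev v c) *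
    (hev (s * u^-1)%g b * hev (t * v^-1)%g e))).
  rewrite tlift_sum2; apply: eq_bigr => u _; apply: eq_bigr => v _.
  by rewrite D_ev mulrC.
move=> b e; rewrite tev_tens; try exact: hev_lin.
rewrite !hevM mulr_suml; apply: eq_bigr => u _.
rewrite mulr_sumr; apply: eq_bigr => v _.
by rewrite mulrACA.
Qed.

Variable eps : 'Hom(HA, k^o).
Hypothesis eps_ev : forall x, (eps x)%:A = gr_eps (vsval x).

Lemma hev_counit_scale t (x y : HA) :
  hev t ((eps x : k) *: y) = \sum_s hev s x * hev t y.
Proof.
rewrite -mulr_suml -[X in X * _]/(gr_eps (vsval x)) -eps_ev mulr_algl.
exact: ffunE.
Qed.

Lemma counitl_of_ev x : tlift (fun a b => (eps a : k) *: b) (D x) = x.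
Proof.
apply: hev_inj => t; rewrite linear_tlift; last exact: hev_lin.
rewrite (eq_tlift _ (fun a b => hev_counit_scale t a b)) tlift_comul_sum.
by rewrite big_pred1_eq.
Qed.

Lemma counitr_of_ev x : tlift (fun a b => (eps b : k) *: a) (D x) = x.
Proof.
apply: hev_inj => t; rewrite linear_tlift; last exact: hev_lin.
rewrite (@eq_tlift _ _ _ _ _ (fun a b => \sum_s hev t a * hev s b)) => [|a b].
  by rewrite tlift_comul_sum (big_pred1 t) // => s; rewrite eq_sym.
by rewrite hev_counit_scale; apply: eq_bigr => s _; rewrite mulrC.
Qed.

Lemma counit1_of_ev : eps 1 = 1.
Proof.
apply: (fmorph_inj (in_alg K)); rewrite /= eps_ev scale1r /gr_eps (bigD1 1%g) //=.
rewrite [X in X + _]hev1 eqxx big1 ?addr0 // => t /negPf t1.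
by rewrite [LHS]hev1 t1.
Qed.

Lemma counitM_of_ev x y : eps (x * y) = eps x * eps y.
Proof.
apply: (fmorph_inj (in_alg K)); rewrite rmorphM /= !eps_ev.
transitivity (\sum_t \sum_u hev u x * hev (t * u^-1)%g y).
  by apply: eq_bigr => t _; rewrite -hevM.
rewrite exchange_big /= mulr_suml; apply: eq_bigr => u _.
by rewrite -mulr_sumr -[in LHS](reindex_inj (mulIg u^-1%g) (P := xpredT)).
Qed.

Variable S : 'End(HA).
Hypothesis S_ev : forall x t, hev t (S x) = hev t^-1%g x.

Lemma hev_counit_alg t x :
  hev t (((eps x : k) *: (1 : HA))) = if t == 1%g then \sum_s hev s x else 0.
Proof.
rewrite hev_counit_scale -mulr_suml hev1.
by case: eqP; rewrite ?mulr1 ?mulr0.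
Qed.

(** The diagonal condition u^-1 = t * u^-1 holds for every u when t = 1 and for none otherwise. *)
Lemma antipodel_of_ev x : tlift (fun a b => S a * b) (D x) = (eps x : k) *: (1 : HA).
Proof.
apply: hev_inj => t; rewrite linear_tlift; last exact: hev_lin.
rewrite (@eq_tlift _ _ _ _ _
  (fun a b => \sum_u hev u^-1%g a * hev (t * u^-1)%g b)) => [|a b]; last first.
  by rewrite hevM; apply: eq_bigr => u _; rewrite S_ev.
rewrite tlift_comul_sum hev_counit_alg.
rewrite (eq_bigl (fun=> t == 1%g)) => [|u]; last first.
  by rewrite eq_sym eq_mulgV1 invgK mulgKV.
case: eqP => _; last exact: big_pred0_eq.
by rewrite [RHS](reindex_inj invg_inj).
Qed.

Lemma antipoder_of_ev x : tlift (fun a b => a * S b) (D x) = (eps x : k) *: (1 : HA).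
Proof.
apply: hev_inj => t; rewrite linear_tlift; last exact: hev_lin.
rewrite (@eq_tlift _ _ _ _ _
  (fun a b => \sum_u hev u a * hev (u * t^-1)%g b)) => [|a b]; last first.
  by rewrite hevM; apply: eq_bigr => u _; rewrite S_ev invMg invgK.
rewrite tlift_comul_sum hev_counit_alg.
rewrite (eq_bigl (fun=> t == 1%g)) => [|u].
  by case: eqP => _; last exact: big_pred0_eq.
by rewrite -[u in u == _]mulg1 (inj_eq (mulgI u)) eq_sym eq_invg1.
Qed.

End GroupLikeComul.

Lemma inherited_hopf_exists (k : fieldType) (K : splittingFieldType k)
    (T : finGroupType) (rho : gal_of {:K} -> T) (E : {subfield K})
    (M : {group T}) :
    galois 1%AS {:K} -> {morph rho : g h / (g * h)%g} ->
    (forall g, rho g \in 'N(M)%g) ->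
    (forall x : group_ring K T, supported M x ->
      (forall g, gr_act rho g x = x) -> forall t, x t \in E) ->
  exists h : hopfAlg (subvs_of (fixed_ring_aspace rho E M)), inherited_hopf h.
Proof.
move=> K_galois rhoM rho_norm fixed_coef.
have [D D_ev] := comul_exists K_galois rhoM rho_norm fixed_coef.
have [eps eps_ev] := @counit_exists _ _ _ K_galois rho E M.
have [S S_ev] := antipode_exists fixed_coef.
exists (HopfAlg (comulA_of_ev K_galois D_ev) (counitl_of_ev D_ev eps_ev)
  (counitr_of_ev D_ev eps_ev) (comul1_of_ev K_galois D_ev)
  (comulM_of_ev K_galois D_ev) (counit1_of_ev eps_ev) (counitM_of_ev eps_ev)
  (antipodel_of_ev D_ev eps_ev S_ev) (antipoder_of_ev D_ev eps_ev S_ev)).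
by split=> /=.
Qed.

(** * Left translations and the P-orbits on G *)

Section LeftTranslations.
Variables (k : fieldType) (K : splittingFieldType k).
Local Notation G := (gal_of {:K}).
Implicit Types (g a : G) (n p : {perm G}) (M : {group {perm G}}).
Local Open Scope group_scope.

Lemma lambdaM : {morph @lambda k K : g h / g * h}.
Proof. by move=> g h; apply/permP=> a; rewrite permM !permE mulgA. Qed.

Lemma lambdaV g : lambda g^-1 = (lambda g)^-1.
Proof.
apply: (mulgI (lambda g)); rewrite mulgV -lambdaM mulgV.
by apply/permP=> a; rewrite permE perm1 mulg1.
Qed.

Lemma conj_lambdaE n g a : (n ^ lambda g) a = n (a * g^-1) * g.
Proof. by rewrite /conjg -lambdaV !permM !permE. Qed.

Lemma lambda_norm M g : lambdaG K \subset 'N(M) -> lambda g \in 'N(M).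
Proof. by move/subsetP; apply; apply: imset_f. Qed.

Lemma regular_subgroup_inj M n m a : regular_subgroup M ->
  n \in M -> m \in M -> n a = m a -> n = m.
Proof.
case/andP=> _ /forallP/(_ a)/eqP C1 nM mM nma.
apply/eqP; rewrite eq_mulgV1 -in_set1 -[[set 1]]C1 inE groupM ?groupV //=.
by apply/astab1P; rewrite /= /aperm permM nma permK.
Qed.

Definition orbit1 M : {set G} := [set (n : {perm G}) 1 | n in M].

Section OrbitCosets.
Variable P : {group {perm G}}.
Hypothesis P_normalized : lambdaG K \subset 'N(P).

(** As left translations normalize [P], the P-orbit of a is the translate by a of the orbit of 1: in
    the usual order, the left coset aJ. *)
Lemma orbit1_div p a : p \in P -> p a * a^-1 \in orbit1 P.
Proof.
move=> pP; apply/imsetP; exists (p ^ lambda a^-1).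
  by rewrite memJ_norm // lambda_norm.
by rewrite conj_lambdaE invgK mul1g.
Qed.

Lemma orbit1_divP a b : b * a^-1 \in orbit1 P -> exists2 p, p \in P & b = p a.
Proof.
case/imsetP=> p pP bp; exists (p ^ lambda a).
  by rewrite memJ_norm // lambda_norm.
by rewrite conj_lambdaE mulgV -bp mulgKV.
Qed.

Fact orbit1_group_set : group_set (orbit1 P).
Proof.
apply/group_setP; split=> [|_ _ /imsetP[n nP ->] /imsetP[m mP ->]].
  by apply/imsetP; exists 1; rewrite ?perm1.
(* Conjugating n by translation by m(1) makes it act at m(1) as n acts at 1, so the orbit is closed
   under products. *)
apply/imsetP; exists (m * n ^ lambda (m 1)).
  by rewrite groupM // memJ_norm // lambda_norm.
by rewrite permM conj_lambdaE mulgV.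
Qed.
Canonical orbit1_group := Group orbit1_group_set.

Variable N : {group {perm G}}.
Hypothesis N_regular : regular_subgroup N.
Hypothesis N_normalized : lambdaG K \subset 'N(N).
Hypothesis P_normal : P <| N.
Hypothesis orbit1_normal : forall g, g \in 'N(orbit1 P).

(* n(j^-1) lies in the P-orbit of n(1), a coset of the normal subgroup        *)
(* orbit1 P, so that n ^ lambda j and n agree at 1 modulo P; N acts freely.   *)
Lemma coset_conj_lambda n j : n \in N -> j \in orbit1 P ->
  coset P (n ^ lambda j) = coset P n.
Proof.
move=> nN jO; have [p pP jp] : exists2 p, p \in P & j^-1 = p 1.
  by have /imsetP[p pP jp] : j^-1 \in orbit1 P; [rewrite groupV | exists p].
have [sPN nPN] := andP P_normal; have nP := subsetP nPN n nN.
have [q qP nq] : exists2 q, q \in P & (n ^ lambda j) 1 = q (n 1).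
  apply: orbit1_divP; rewrite conj_lambdaE mul1g jp.
  have -> : n (p 1) = (p ^ n) (n 1) by rewrite -!permM -conjgC.
  set c := (p ^ n) (n 1).
  (* Normality of the orbit puts the conjugate of j in it; the other factor is the displacement of
     n(1) by an element of [P]. *)
  have -> : c * j * (n 1)^-1 = j ^ c^-1 * (c * (n 1)^-1).
    by rewrite conjgE invgK !mulgA mulgKV.
  rewrite groupM ?memJ_norm //; apply: orbit1_div.
  by rewrite memJ_norm.
have -> : n ^ lambda j = n * q.
  apply: (regular_subgroup_inj (a := 1) N_regular).
  - by rewrite memJ_norm // lambda_norm.
  - by rewrite groupM // (subsetP sPN).
  by rewrite nq permM.
by rewrite coset_morphM ?(subsetP (normG P) q) //= (coset_id qP) mulg1.
Qed.

End OrbitCosets.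
End LeftTranslations.

(** * The field [F], the group J and the coefficients of invariants of K[N/P] *)

Section FixedField.
Variables (k : fieldType) (K : splittingFieldType k).
Hypothesis K_galois : galois 1%AS {:K}.
Local Notation G := (gal_of {:K}).
Variables (P : {group {perm G}}) (F : {subfield K}).
Hypothesis P_normalized : (lambdaG K \subset 'N(P))%g.
Hypothesis F_def : is_fixed_field (fixed_ring (@lambda k K) {:K}%AS P) F.

Lemma hopf_act_sub_eps (h : group_ring K {perm G}) (x : K) :
  hopf_act h x - gr_eps h * x = \sum_n h n * (((n^-1)%g 1%g : G) x - x).
Proof.
by rewrite /hopf_act mulr_suml -sumrB; apply: eq_bigr => n _; rewrite mulrBr.
Qed.

(** The expression h(x) - eps(h)x is [K]-linear in h, so if it vanishes on the fixed ring it
    vanishes on all of K[P]. At the group element n^-1 it equals n(1)(x) - x, because [hopf_act]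
    inverts. *)
Lemma fixed_field_orbit1 : F = fixedField (orbit1 P) :> {vspace K}.
Proof.
apply/vspaceP=> x; apply/idP/idP=> [/F_def xF|/mem_fixedFieldP[_ xP]].
  apply/(fixedFieldP (memvf x)) => _ /imsetP[n nP ->].
  have [m [b bP]] := fixed_ring_span (@lambdaM k K)
    (fun g => lambda_norm g P_normalized)
    (fun (y : group_ring K {perm G}) _ _ t => memvf (y t)).
  have [w [wH _ nw]] := bP _ (supported_point K n^-1%g).
  apply/eqP; rewrite -subr_eq0; apply/eqP.
  transitivity (\sum_t gr_point K P n^-1%g t * (((t^-1)%g 1%g : G) x - x)).
    rewrite (bigD1 n^-1%g) //= big1 => [|t /negPf tn]; last first.
      by rewrite ffunE tn mul0r.
    by rewrite ffunE eqxx groupV nP invgK mul1r addr0.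
  under eq_bigr do rewrite nw mulr_suml.
  rewrite exchange_big big1 // => i _.
  under eq_bigr do rewrite -mulrA; rewrite -mulr_sumr -hopf_act_sub_eps.
  by rewrite xF ?subrr ?mulr0 //; apply: wH.
apply/F_def=> h hP; apply/eqP; rewrite -subr_eq0 hopf_act_sub_eps big1 // => n _.
case: (boolP (n \in P)) => [nP|/(fixed_ring_supp hP)->]; last by rewrite mul0r.
by rewrite xP ?subrr ?mulr0 //; apply: imset_f; rewrite groupV.
Qed.

Lemma gal_fixed_field : ('Gal({:K} / F) = orbit1 P)%g.
Proof.
rewrite fixed_field_orbit1.
exact: (gal_fixedField (orbit1_group P_normalized)).
Qed.

Variable N : {group {perm G}}.
Hypothesis N_regular : regular_subgroup N.
Hypothesis N_normalized : (lambdaG K \subset 'N(N))%g.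
Hypothesis P_normal : (P <| N)%g.
Hypothesis J_normal : ('Gal({:K} / F) <| 'Gal({:K} / 1))%g.

Lemma orbit1_norm g : g \in 'N(orbit1 P)%g.
Proof.
rewrite -gal_fixed_field (subsetP (normal_norm J_normal)) //.
by rewrite gal_kAut ?sub1v // kAut1E subvf.
Qed.

Lemma lambda_cosetM : {morph @lambda_coset k K P : g h / (g * h)%g}.
Proof. by move=> g h; rewrite /lambda_coset lambdaM coset_morphM ?lambda_norm. Qed.

Lemma lambda_coset_norm g : lambda_coset P g \in 'N(N / P)%g.
Proof.
have /subsetP := quotient_norms P N_normalized; apply.
by apply: mem_morphim; [apply: lambda_norm | apply: imset_f].
Qed.

(** For j in J, conjugation by lambda(j) is trivial on N/P, so invariance under j says that j fixes
    each coefficient. *)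
Lemma fixed_quotient_coef (x : group_ring K (coset_of P)) :
    supported (N / P)%g x -> (forall g, gr_act (lambda_coset P) g x = x) ->
  forall t, x t \in F.
Proof.
move=> xN x_fix t; case: (boolP (t \in N / P)%g) => [|/xN->]; last exact: mem0v.
case/morphimP=> n nP nN ->; rewrite fixed_field_orbit1.
apply/fixedFieldP=> [|j jO]; first exact: memvf.
have /ffunP/(_ (coset P n)) := x_fix j; rewrite ffunE.
suff -> : (coset P n ^ (lambda_coset P j)^-1 = coset P n)%g by [].
apply: (canLR (conjgK _)).
have eq_nj := coset_conj_lambda P_normalized N_regular N_normalized P_normal
  orbit1_norm nN jO.
by rewrite -{1}eq_nj; apply: (morphJ (coset_morphism P)) => //; apply: lambda_norm.
Qed.

End FixedField.

Lemma gr_mapE (k : fieldType) (K : fieldExtType k) (T T' : finGroupType)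
    (phi : T -> T') (x : group_ring K T) (t' : T') :
  gr_map phi x t' = \sum_t (phi t == t')%:R * x t.
Proof.
rewrite ffunE big_mkcond; apply: eq_bigr => t _.
by case: eqP; rewrite ?mul1r ?mul0r.
Qed.

Lemma gr_map_eps (k : fieldType) (K : fieldExtType k) (T T' : finGroupType)
    (phi : T -> T') (x : group_ring K T) :
  gr_eps (gr_map phi x) = gr_eps x.
Proof.
rewrite /gr_eps [RHS](partition_big phi predT) //=.
by apply: eq_bigr => t' _; rewrite ffunE.
Qed.

(** * Hopf morphisms induced by maps of groups *)

Section InheritedHopf.
Variables (k : fieldType) (K : splittingFieldType k) (T : finGroupType).
Local Notation G := (gal_of {:K}).
Variables (rho : G -> T) (E : {subfield K}) (M : {group T}).
Local Notation HA := (subvs_of (fixed_ring_aspace rho E M)).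
Local Notation hev := (@hev k K T rho E M).
Variables (h : hopfAlg HA) (h_inh : inherited_hopf h).

Lemma tlift_inherited_comul (phi : T -> T -> K) x :
  tlift (fun a b => \sum_s \sum_t phi s t * (hev s a * hev t b)) (comul h x) =
    \sum_s phi s s * hev s x.
Proof.
rewrite tlift_sum2; apply: eq_bigr => s _.
rewrite (bigD1 s) //= [tev _ _ _](inherited_comul h_inh) eqxx big1 ?addr0 // => t ts.
by rewrite [tev _ _ _](inherited_comul h_inh) eq_sym (negPf ts) mulr0.
Qed.

Lemma hev_antipode t x : hev t (antipode h x) = hev t^-1%g x.
Proof. exact: inherited_antipode. Qed.

End InheritedHopf.

Section GroupRingMorphism.
Variables (k : fieldType) (K : splittingFieldType k).
Hypothesis K_galois : galois 1%AS {:K}.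
Local Notation G := (gal_of {:K}).
Variables (T T' : finGroupType) (rho : G -> T) (rho' : G -> T').
Variables (E E' : {subfield K}) (M : {group T}) (M' : {group T'}).
Local Notation A := (subvs_of (fixed_ring_aspace rho E M)).
Local Notation B := (subvs_of (fixed_ring_aspace rho' E' M')).
Variables (hA : hopfAlg A) (hB : hopfAlg B).
Hypotheses (hA_inh : inherited_hopf hA) (hB_inh : inherited_hopf hB).
Variables (phi : T -> T') (f : 'Hom(A, B)).
Hypothesis phiM : {in M &, {morph phi : s t / (s * t)%g}}.
Hypothesis f_map : forall x, vsval (f x) = gr_map phi (vsval x).

Lemma hev_map t' x : hev t' (f x) = \sum_t (phi t == t')%:R * hev t x.
Proof. by rewrite /hev f_map gr_mapE. Qed.

(** Multiplicativity of [phi] on [M] suffices because coefficients vanish off [M]; this covers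
    [coset P], a morphism only on the normalizer of [P]. *)
Lemma gr_map_hopf_morphism : hopf_morphism hA hB f.
Proof.
have phi1 : phi 1%g = 1%g.
  by apply: (mulgI (phi 1%g)); rewrite -phiM ?group1 ?mulg1.
split=> [|a b|a|a|a].
- apply: hev_inj => q; rewrite hev_map (bigD1 1%g) //= big1 => [|s /negPf s1].
    by rewrite !hev1 eqxx phi1 mulr1 addr0 eq_sym.
  by rewrite hev1 s1 mulr0.
- apply: hev_inj => q; rewrite hev_map hevM.
  transitivity (\sum_s \sum_u \sum_v
      (phi u == v)%:R * ((phi s == q * v^-1)%g%:R * (hev u a * hev s b))).
    transitivity (\sum_s \sum_u (phi (s * u)%g == q)%:R * (hev u a * hev s b)).
      under eq_bigr do rewrite hevM mulr_sumr.
      rewrite exchange_big [RHS]exchange_big; apply: eq_bigr => u _ /=.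
      by rewrite (reindex_inj (mulIg u)); apply: eq_bigr => s _; rewrite mulgK.
    apply: eq_bigr => s _; apply: eq_bigr => u _.
    rewrite (bigD1 (phi u)) //= big1 => [|v /negPf vu]; last first.
      by rewrite eq_sym vu mul0r.
    rewrite eqxx mul1r addr0.
    case: (boolP (u \in M)) => [uM|/hev_supp->]; last by rewrite !(mul0r, mulr0).
    case: (boolP (s \in M)) => [sM|/hev_supp->]; last by rewrite !(mul0r, mulr0).
    by rewrite phiM // (canF_eq (mulgK _)).
  rewrite exchange_big; under eq_bigr do rewrite exchange_big.
  rewrite exchange_big; apply: eq_bigr => v _ /=.
  rewrite !hev_map mulr_suml; apply: eq_bigr => u _.
  rewrite mulr_sumr; apply: eq_bigr => s _.
  by rewrite -!mulrA [hev u a * _ in RHS]mulrCA.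
- apply: (tev_hev_inj K_galois) => q r.
  rewrite [LHS](inherited_comul hB_inh) -/(hev q (f a)) hev_map.
  rewrite tev_tmap; try exact: hev_linear.
  transitivity (tlift (fun x y => \sum_s \sum_t
      ((phi s == q)%:R * (phi t == r)%:R) * (hev s x * hev t y)) (comul hA a)).
    rewrite (tlift_inherited_comul hA_inh); case: eqP => [<-|qr].
      by apply: eq_bigr => s _; rewrite -natrM mulnb andbb.
    rewrite big1 // => s _; rewrite -natrM mulnb.
    by case: (phi s =P q) => /= [->|_]; [case: eqP|]; rewrite ?mul0r.
  apply: eq_tlift => x y /=; rewrite !hev_map mulr_suml; apply: eq_bigr => s _.
  by rewrite mulr_sumr; apply: eq_bigr => t _; rewrite mulrACA.
- apply: (fmorph_inj (in_alg K)).
  rewrite /= (inherited_counit hB_inh) (inherited_counit hA_inh).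
  by rewrite f_map gr_map_eps.
apply: hev_inj => q; rewrite (hev_antipode hB_inh) !hev_map.
rewrite [RHS](reindex_inj invg_inj); apply: eq_bigr => s _.
rewrite (hev_antipode hA_inh) invgK.
case: (boolP (s \in M)) => [sM|/hev_supp->]; last by rewrite !mulr0.
have phiV : phi s^-1%g = (phi s)^-1%g.
  by apply: (mulgI (phi s)); rewrite -phiM ?groupV // !mulgV.
by rewrite phiV eq_invg_sym eq_sym.
Qed.

End GroupRingMorphism.

(** * The maps of the sequence and its exactness *)

Section Sequence.
Variables (k : fieldType) (K : splittingFieldType k).
Hypothesis K_galois : galois 1%AS {:K}.
Local Notation G := (gal_of {:K}).
Local Notation KT := (group_ring K {perm G}).
Variables N P : {group {perm G}}.
Hypothesis N_normalized : (lambdaG K \subset 'N(N))%g.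
Hypothesis P_normal : (P <| N)%g.
Hypothesis P_normalized : (lambdaG K \subset 'N(P))%g.
Variable F : {subfield K}.
Hypothesis quotient_coef : forall x : group_ring K (coset_of P),
  supported (N / P)%g x -> (forall g, gr_act (lambda_coset P) g x = x) ->
  forall t, x t \in F.

Local Notation HP := (fixed_ring_aspace (@lambda k K) {:K}%AS P).
Local Notation HN := (fixed_ring_aspace (@lambda k K) {:K}%AS N).
Local Notation HQ := (fixed_ring_aspace (lambda_coset P) F (N / P)%G).

Let sPN : {subset P <= N}. Proof. exact: subsetP (normal_sub P_normal). Qed.
Let nPN : {subset N <= 'N(P)%g}. Proof. exact: subsetP (normal_norm P_normal). Qed.

Let full_coef (M : {group {perm G}}) (x : KT) :
  supported M x -> (forall g, gr_act (@lambda k K) g x = x) ->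
  forall t, x t \in {:K}%AS.
Proof. by move=> _ _ t; apply: memvf. Qed.

Lemma fixed_ring_lambdaS x : x \in HP -> x \in HN.
Proof.
move=> xP; apply: (mem_fixed_ring (@full_coef N)) => [t tN|g t].
  by apply: (fixed_ring_supp xP); apply: contra tN; apply: sPN.
exact: fixed_ring_act xP.
Qed.

Lemma fixed_ring_lambda_supp x : x \in HN -> supported P x -> x \in HP.
Proof.
move=> xN xP; apply: (mem_fixed_ring (@full_coef P)) => // g t.
exact: fixed_ring_act xN.
Qed.

Lemma fixed_ring_quotient x : x \in HN -> gr_map (coset P) x \in HQ.
Proof.
move=> xN; apply: (mem_fixed_ring quotient_coef) => [q qN|g q].
  rewrite ffunE big1 // => t /eqP tq; apply: (fixed_ring_supp xN).
  by apply: contra qN => tN; rewrite -tq mem_quotient.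
rewrite !gr_mapE rmorph_sum (reindex_inj (conjg_inj (lambda g))).
apply: eq_bigr => t _ /=.
rewrite rmorphM (fixed_ring_act g _ xN) conjgK rmorph_nat.
case: (boolP (t \in N)) => [/nPN tN|/(fixed_ring_supp xN)->]; last first.
  by rewrite !(rmorph0, mulr0).
have nPg := lambda_norm g P_normalized.
have -> : (coset P (t ^ lambda g) = coset P t ^ lambda_coset P g)%g.
  exact: (morphJ (coset_morphism P)).
by rewrite (canF_eq (conjgK _)).
Qed.

Lemma inclusion_exists : exists i : 'Hom(subvs_of HP, subvs_of HN),
  forall x, vsval (i x) = vsval x.
Proof.
exists (linfun (vsproj HN \o vsval)) => x; rewrite lfunE /= vsprojK //.
exact: fixed_ring_lambdaS (subvsP x).
Qed.

Lemma projection_exists : exists p : 'Hom(subvs_of HN, subvs_of HQ),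
  forall x, vsval (p x) = gr_map (coset P) (vsval x).
Proof.
have [q|q|x|p pP] := @lfun_choice k K (subvs_of HN) (subvs_of HQ) (coset_of P)
  (fun q x => gr_map (coset P) (vsval x) q) (fun q => hev q).
- move=> c x y; rewrite !gr_mapE scaler_sumr -big_split; apply: eq_bigr => t _ /=.
  by rewrite !ffunE mulrDr scalerAr.
- exact: hev_linear.
- exists (vsproj HQ (gr_map (coset P) (vsval x))) => q.
  by rewrite hev_vsproj // fixed_ring_quotient // subvsP.
by exists p => x; apply/ffunP=> q; rewrite -pP.
Qed.

Variable i : 'Hom(subvs_of HP, subvs_of HN).
Hypothesis i_val : forall x, vsval (i x) = vsval x.
Variable p : 'Hom(subvs_of HN, subvs_of HQ).
Hypothesis p_val : forall x, vsval (p x) = gr_map (coset P) (vsval x).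

Lemma mem_limg_inclusion b : b \in limg i <-> supported P (vsval b).
Proof.
split=> [/memv_imgP[a _ ->]|bP].
  by rewrite i_val; apply: fixed_ring_supp (subvsP a).
apply/memv_imgP; exists (vsproj HP (vsval b)); rewrite ?memvf //.
apply/val_inj; rewrite /= i_val vsprojK //.
exact: fixed_ring_lambda_supp (subvsP b) bP.
Qed.

Lemma inclusion_inj : injective i.
Proof. by move=> x y /(congr1 vsval); rewrite !i_val => /val_inj. Qed.

(** Cosets outside N/P get the representative 1, so that [r q] always lies in [N]. *)
Let cosetrep : exists r : coset_of P -> {perm G},
  forall q, r q \in N /\ (q \in (N / P)%g -> coset P (r q) = q).
Proof.
apply: (fin_all_exists (P := fun q n => n \in N /\ (_ -> coset P n = q))) => q.
case: (boolP (q \in (N / P)%g)) => [/morphimP[n _ nN ->]|_]; first by exists n.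
by exists 1%g; rewrite group1.
Qed.

Let lambda_span (M : {group {perm G}}) (nM : (lambdaG K \subset 'N(M))%g) :=
  fixed_ring_span (@lambdaM k K) (fun g => lambda_norm g nM) (@full_coef M).

(** The lift \sum_q c_q r(q) to K[N] need not be invariant; descent is applied to its image c, which
    is, with the forms [hev q (p x)]. *)
Lemma projection_surj c : exists b, p b = c.
Proof.
have [n [b bP]] := lambda_span N_normalized.
have [r rP] := cosetrep.
have /fin_all_exists[w wP] q := bP _ (supported_point K (r q)).
pose cf (j : coset_of P * 'I_n) := hev j.1 c * b j.2.
pose v (j : coset_of P * 'I_n) := vsproj HN (w j.1 j.2).
pose act (g : G) (q : coset_of P) := (q ^ (lambda_coset P g)^-1)%g.
have [q|g q x _|g q|j|q|x _ xc] := @galois_descent k K K_galois (subvs_of HN)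
  fullv (coset_of P) act (fun q x => hev q (p x)) (fun q => hev q c) _ cf v.
- by move=> a x y; rewrite linearP; apply: hev_linear.
- exact: hev_act.
- exact: hev_act.
- exact: memvf.
- transitivity (\sum_q' hev q' c * \sum_t (coset P t == q)%:R * gr_point K N (r q') t).
    rewrite (bigD1 q) //= [X in _ + X]big1 => [|q' /negPf q'q]; last first.
      have [rN rq'] := rP q'.
      case: (boolP (q' \in N / P)%g) => [/rq' rK|/hev_supp->]; last exact: mul0r.
      rewrite big1 ?mulr0 // => t _; rewrite ffunE.
      by case: (t =P r q') => [->|]; rewrite ?mulr0 // rK q'q mul0r.
    have [rN rq] := rP q.
    rewrite (bigD1 (r q)) //= big1 => [|t /negPf tr]; last first.
      by rewrite ffunE tr mulr0.
    rewrite ffunE eqxx rN mulr1 !addr0.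
    case: (boolP (q \in N / P)%g) => [/rq->|/hev_supp->]; last by rewrite mul0r.
    by rewrite eqxx mulr1.
  rewrite -(pair_bigA _ (fun q' j => cf (q', j) * hev q (p (v (q', j))))) /=.
  apply: eq_bigr => q' _; have [wH _ wE] := wP q'.
  under eq_bigr do rewrite wE mulr_sumr.
  rewrite exchange_big mulr_sumr; apply: eq_bigr => j _.
  rewrite /cf -mulrA; congr (_ * _).
  rewrite /hev p_val gr_mapE mulr_sumr; apply: eq_bigr => t _.
  by rewrite /v vsprojK // mulrCA.
by exists x; apply: hev_inj.
Qed.

Variables (hP : hopfAlg (subvs_of HP)) (hN : hopfAlg (subvs_of HN)).
Variable hQ : hopfAlg (subvs_of HQ).
Hypotheses (hP_inh : inherited_hopf hP) (hN_inh : inherited_hopf hN).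
Hypothesis hQ_inh : inherited_hopf hQ.

Lemma inclusion_morphism : hopf_morphism hP hN i.
Proof.
apply: (gr_map_hopf_morphism K_galois hP_inh hN_inh (phi := id)) => // x.
rewrite i_val; apply/ffunP=> t; rewrite ffunE.
by rewrite big_pred1_eq.
Qed.

Lemma projection_morphism : hopf_morphism hN hQ p.
Proof.
apply: (gr_map_hopf_morphism K_galois hN_inh hQ_inh (phi := coset P)) => //.
by move=> s t sN tN; rewrite coset_morphM // nPN.
Qed.

Lemma inclusion_normal : normal_hopf_subalgebra hN (limg i).
Proof.
have [i1 iM iD ie iS] := inclusion_morphism.
split; first split.
- by rewrite -i1 memv_img ?memvf.
- move=> _ _ /memv_imgP[a _ ->] /memv_imgP[b _ ->].
  by rewrite -iM memv_img ?memvf.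
- move=> _ /memv_imgP[a _ ->].
  pose i' : 'Hom(_, _) := linfun (vsproj (limg i) \o i).
  have i'K x : vsval (i' x) = i x.
    by rewrite lfunE /= vsprojK // memv_img ?memvf.
  exists (tmap i' i' (comul hP a)); rewrite iD.
  rewrite [RHS]linear_tlift; last exact: tlift_linear.
  apply: eq_tlift => x y; rewrite [RHS]tlift_tens ?i'K //.
    by move=> u c s t; rewrite linearP tens_linearr.
  by move=> u c s t; rewrite linearP tens_linearl.
- move=> _ /memv_imgP[a _ ->].
  by rewrite iS memv_img ?memvf.
- move=> a b /mem_limg_inclusion aP; apply/mem_limg_inclusion => t tP.
  rewrite -[LHS]/(hev t _) linear_tlift; last exact: hev_linear.
  (* On the diagonal u = v this reads [a] at a conjugate of t by an element of [N], which stays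
     outside [P] as [P] is normal. *)
  pose phi u v := hev (v * t * u^-1)%g a.
  rewrite (@eq_tlift _ _ _ _ _ (fun x y =>
      \sum_u \sum_v phi u v * (hev u x * hev v y))) => [|x y].
    rewrite (tlift_inherited_comul hN_inh) big1 // => u _.
    case: (boolP (u \in N)) => [uN|/hev_supp->]; last exact: mulr0.
    rewrite /phi [hev _ a]aP ?mul0r //.
    have -> : (u * t * u^-1 = t ^ u^-1)%g by rewrite conjgE invgK mulgA.
    by rewrite memJ_norm ?groupV ?nPN.
  rewrite hevM [RHS]exchange_big (reindex_inj (mulIg t)) /=.
  apply: eq_bigr => v _; rewrite hevM mulr_suml; apply: eq_bigr => u _.
  rewrite (hev_antipode hN_inh) /phi.
  have -> : ((t * (v * t)^-1)^-1 = v)%g by rewrite invMg invgK mulgK.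
  by rewrite [RHS]mulrCA mulrA.
move=> a b /mem_limg_inclusion aP; apply/mem_limg_inclusion => t tP.
rewrite -[LHS]/(hev t _) linear_tlift; last exact: hev_linear.
pose phi u v := hev (v^-1 * t * u)%g a.
rewrite (@eq_tlift _ _ _ _ _ (fun x y =>
    \sum_u \sum_v phi u v * (hev u x * hev v y))) => [|x y].
  rewrite (tlift_inherited_comul hN_inh) big1 // => u _.
  case: (boolP (u \in N)) => [uN|/hev_supp->]; last exact: mulr0.
  rewrite /phi [hev _ a]aP ?mul0r //.
  by rewrite -mulgA memJ_norm ?nPN.
rewrite hevM [RHS]exchange_big (reindex_inj invg_inj) (reindex_inj (mulgI t^-1%g)).
apply: eq_bigr => v _ /=; rewrite hevM mulr_suml (reindex_inj invg_inj).
apply: eq_bigr => u _ /=.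
rewrite (hev_antipode hN_inh) !invMg !invgK /phi.
by rewrite mulKVg [RHS]mulrCA mulrA.
Qed.

Let ker_ideal := ({:subvs_of HN} * (limg i :&: lker (counit hN)))%VS.

Lemma mem_limg_counit b : supported P (vsval b) -> gr_eps (vsval b) = 0 ->
  b \in (limg i :&: lker (counit hN))%VS.
Proof.
move=> bP b0; rewrite memv_cap memv_ker; apply/andP; split.
  exact/mem_limg_inclusion.
apply/eqP/(fmorph_inj (in_alg K)); rewrite rmorph0 /=.
by rewrite (inherited_counit hN_inh).
Qed.

(* If t = s r with r the representative of the coset of t, then              *)
(* \sum_t x_t t = \sum_t x_t (s - 1) r, since the coset sums of x vanish; the  *)
(* factors are then expanded on the fixed rings and the sum descended.        *)
Lemma sub_lker_projection : (lker p <= ker_ideal)%VS.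
Proof.
apply/subvP=> x; rewrite memv_ker => /eqP px.
have [n [b bP]] := lambda_span N_normalized.
have [m [d dP]] := lambda_span P_normalized.
have [r rP] := cosetrep.
have /fin_all_exists[w wP] t := bP _ (supported_point K (r (coset P t))).
(* The value 1 off [N] keeps [s t] in [P]; [x] has no coefficient there. *)
pose s t := if t \in N then (t * (r (coset P t))^-1)%g else 1%g.
have sP t : s t \in P.
  rewrite /s; case: ifP => // tN; have [rN rt] := rP (coset P t).
  apply: coset_idr; first by rewrite nPN // groupM ?groupV.
  by rewrite coset_morphM ?groupV ?nPN // morphV ?nPN //= rt ?mulgV ?mem_quotient.
pose y t : KT := gr_point K P (s t) - gr_point K P 1%g.
have yP t : supported P (y t).
  by move=> u uP; rewrite !ffunE (negPf uP) !andbF subrr.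
have y0 t : gr_eps (y t) = 0.
  have eps1 u : u \in P -> gr_eps (gr_point K P u) = 1.
    move=> uP; rewrite /gr_eps (bigD1 u) //= big1 => [|v /negPf vu].
      by rewrite ffunE eqxx uP addr0.
    by rewrite ffunE vu.
  transitivity (gr_eps (gr_point K P (s t)) - gr_eps (gr_point K P 1%g)).
    by rewrite /gr_eps -sumrB; apply: eq_bigr => u _; rewrite !ffunE.
  by rewrite !eps1 ?subrr.
have /fin_all_exists[z zP] t := dP _ (yP t).
pose cf (j : {perm G} * ('I_n * 'I_m)) := hev j.1 x * (b j.2.1 * d j.2.2).
(* K[T] multiplies in the order opposite to [*] on permutations, so the augmentation factor from [P]
   stands on the right, as the left ideal requires. *)
pose v (j : {perm G} * ('I_n * 'I_m)) :=
  vsproj HN (w j.1 j.2.1) * vsproj HN (z j.1 j.2.2).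
pose act (g : G) (t : {perm G}) := (t ^ (lambda g)^-1)%g.
have zN t l : z t l \in HN.
  by have [zH _ _] := zP t; apply: fixed_ring_lambdaS.
have [t|g t u _|g t|[t [j l]]|t|u uI ux] := @galois_descent k K K_galois
  (subvs_of HN) ker_ideal {perm G} act (fun t => hev t) (fun t => hev t x) _ cf v.
- exact: hev_linear.
- exact: hev_act.
- exact: hev_act.
- have [zH zeps _] := zP t.
  apply: memv_mul; first exact: memvf.
  apply: mem_limg_counit; rewrite /= vsprojK ?zN //.
    exact: fixed_ring_supp (zH l).
  exact: zeps (y0 t) l.
- transitivity (\sum_u hev u x *
      \sum_q gr_point K N (r (coset P u)) q * y u (t * q^-1)%g).
    transitivity (\sum_u hev u x * (t == u)%:R -
        \sum_u hev u x * (t == r (coset P u))%:R).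
      rewrite (bigD1 t) //= eqxx mulr1 [X in _ + X - _]big1 => [|u /negPf ut].
        (* The subtracted terms are grouped by coset: each group is a coefficient of [p x], hence
           zero. *)
        rewrite addr0 (partition_big (coset P) predT) //= big1 ?subr0 // => q _.
        transitivity ((t == r q)%:R * hev q (p x)); last first.
          by rewrite px /hev ffunE mulr0.
        rewrite (hev_map p_val) mulr_sumr big_mkcond; apply: eq_bigr => u _.
        by case: eqP => [->|_]; rewrite ?mul1r 1?mulrC // !(mul0r, mulr0).
      by rewrite eq_sym ut mulr0.
    rewrite -sumrB; apply: eq_bigr => u _; rewrite -mulrBr.
    case: (boolP (u \in N)) => [uN|/hev_supp->]; last by rewrite !mul0r.
    have [rN _] := rP (coset P u); congr (_ * _).
    rewrite (bigD1 (r (coset P u))) //= big1 => [|q /negPf qr]; last first.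
      by rewrite ffunE qr mul0r.
    rewrite ffunE eqxx rN mul1r addr0 !ffunE /s uN -eq_mulgV1 (inj_eq (mulIg _)).
    have := sP u; rewrite /s uN => suP.
    by congr (_ - _); case: eqP => // ->; rewrite ?suP ?mulgV ?group1.
  rewrite -(pair_bigA _ (fun u q => cf (u, q) * hev t (v (u, q)))) /=.
  apply: eq_bigr => u _; have [wH _ wE] := wP u; have [zH _ zE] := zP u.
  rewrite -(pair_bigA _ (fun j l => cf (u, (j, l)) * hev t (v (u, (j, l))))) /=.
  under eq_bigr do rewrite wE mulr_suml.
  rewrite exchange_big mulr_sumr; apply: eq_bigr => j _ /=.
  under eq_bigr do rewrite zE mulr_sumr.
  rewrite exchange_big mulr_sumr; apply: eq_bigr => l _ /=.
  rewrite /cf /v /= -mulrA; congr (_ * _).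
  rewrite hevM mulr_sumr; apply: eq_bigr => q _.
  by rewrite !hev_vsproj // mulrACA.
by rewrite -(hev_inj ux).
Qed.

(** For the remaining inclusion, an element supported on [P] is sent to its augmentation times 1. *)
Lemma projection_ker : lker p = ker_ideal.
Proof.
apply/eqP; rewrite eqEsubv sub_lker_projection; apply/prodvP=> a b _.
rewrite memv_cap !memv_ker => /andP[/mem_limg_inclusion bP /eqP b0].
have [_ pM _ _ _] := projection_morphism.
suff pb : p b = 0 by rewrite pM pb mulr0.
apply: hev_inj => q; rewrite (hev_map p_val).
transitivity ((1%g == q)%:R * gr_eps (vsval b)); last first.
  rewrite -(inherited_counit hN_inh) b0 scale0r mulr0.
  by rewrite /hev ffunE.
rewrite mulr_sumr; apply: eq_bigr => t _.
by rewrite /hev; case: (boolP (t \in P)) => [/coset_id->|/bP->]; rewrite ?mulr0.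
Qed.

(** At (s, q) the left tensor has b_s when sP = q, the right one b_s when q = 1; comparing them at q
    = sP forces b_s = 0 for s in [N] outside [P]. *)
Lemma projection_coker b :
  b \in limg i <-> tmap id p (comul hN b) = tens b 1.
Proof.
have ev s q : tev (hev s) (hev q) (tmap id p (comul hN b)) =
    (coset P s == q)%:R * hev s b.
  rewrite tev_tmap; try exact: hev_linear.
  transitivity (tlift (fun x y => \sum_u \sum_t
      ((u == s)%:R * (coset P t == q)%:R) * (hev u x * hev t y)) (comul hN b)).
    apply: eq_tlift => x y /=; rewrite (bigD1 s) //= [X in _ + X]big1 => [|u /negPf us].
      rewrite addr0 (hev_map p_val) mulr_sumr; apply: eq_bigr => t _.
      by rewrite eqxx mul1r mulrCA.
    by rewrite big1 // => t _; rewrite us !mul0r.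
  rewrite (tlift_inherited_comul hN_inh) (bigD1 s) //= big1 => [|u /negPf us].
    by rewrite eqxx mul1r addr0.
  by rewrite us !mul0r.
have ev1 s q : tev (hev s) (hev q) (tens b (1 : subvs_of HQ)) =
    (q == 1%g)%:R * hev s b.
  by rewrite tev_tens ?hev1 1?mulrC //; apply: hev_linear.
split=> [/mem_limg_inclusion bP|eqb].
  apply: (K_indep_inj (e := fun sq => tev (hev sq.1) (hev sq.2))).
  - by move=> sq; apply: tev_linear.
  - by apply: K_indep_tensor; apply: hev_K_indep.
  move=> [s q] /=; rewrite ev ev1.
  case: (boolP (s \in P)) => [/coset_id->|/bP sP]; first by rewrite eq_sym.
  by rewrite [hev s b]sP !mulr0.
apply/mem_limg_inclusion => s sP.
case: (boolP (s \in N)) => [/nPN sN|/hev_supp]; last exact.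
have := ev1 s (coset P s); rewrite -eqb ev eqxx mul1r.
case: eqP => [/(coset_idr sN)|_]; first by rewrite (negPf sP).
by rewrite mul0r.
Qed.

End Sequence.

Theorem theorem3p1 (k : fieldType) (K : splittingFieldType k)
    (K_galois : galois 1%AS {:K})
    (N P : {group {perm gal_of {:K}}})
    (N_regular : regular_subgroup N)
    (N_normalized : lambdaG K \subset 'N(N)%g)
    (P_normal : (P <| N)%g)
    (P_normalized : lambdaG K \subset 'N(P)%g)
    (F : {subfield K})
    (F_def : is_fixed_field (fixed_ring (@lambda k K) {:K}%AS P) F)
    (J_normal : ('Gal({:K} / F) <| 'Gal({:K} / 1))%g) :
  let H_P := fixed_ring_aspace (@lambda k K) {:K}%AS P in
  let H_N := fixed_ring_aspace (@lambda k K) {:K}%AS N in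
  let H_Q := fixed_ring_aspace (lambda_coset P) F (N / P)%G in
  exists (hP : hopfAlg (subvs_of H_P)) (hN : hopfAlg (subvs_of H_N))
         (hQ : hopfAlg (subvs_of H_Q))
         (i : 'Hom(subvs_of H_P, subvs_of H_N))
         (p : 'Hom(subvs_of H_N, subvs_of H_Q)),
    [/\ inherited_hopf hP, inherited_hopf hN & inherited_hopf hQ] /\
    (forall x, vsval (i x) = vsval x) /\
    (forall x, vsval (p x) = gr_map (coset P) (vsval x)) /\
    hopf_short_exact hP hN hQ i p.
Proof.
move=> H_P H_N H_Q.
have quotient_coef := @fixed_quotient_coef k K P F P_normalized F_def N
  N_regular N_normalized P_normal J_normal.
have lambda_hopf (M : {group {perm gal_of {:K}}}) :
    lambdaG K \subset 'N(M)%g ->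
    exists h : hopfAlg (subvs_of (fixed_ring_aspace (@lambda k K) {:K}%AS M)),
      inherited_hopf h.
  move=> nM; apply: inherited_hopf_exists => // [|g|x _ _ t].
  - exact: lambdaM.
  - exact: lambda_norm.
  exact: memvf.
have [hP hP_inh] := lambda_hopf P P_normalized.
have [hN hN_inh] := lambda_hopf N N_normalized.
have [hQ hQ_inh] : exists h : hopfAlg (subvs_of H_Q), inherited_hopf h.
  apply: inherited_hopf_exists => //; first exact: lambda_cosetM.
  exact: lambda_coset_norm.
have [i i_val] := inclusion_exists P_normal.
have [p p_val] := projection_exists P_normal P_normalized quotient_coef.
exists hP, hN, hQ, i, p; split=> //; split=> //; split=> //.
split.
- exact: inclusion_morphism.
- exact: projection_morphism.
- exact: inclusion_inj.
- exact: projection_surj.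
- exact: (inclusion_normal K_galois P_normal i_val hP_inh hN_inh).
- exact: (projection_ker K_galois N_normalized P_normal P_normalized i_val p_val
    hN_inh hQ_inh).
- exact: (projection_coker K_galois P_normal i_val p_val hN_inh).
Qed.
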